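(* Let $k\ge 1$ be an integer and let $a_1,b_1\ge 0$ be real numbers. Let $N$ tend to infinity through the positive integers, and let $a=a(N)>0$ and $b=b(N)>0$ be real parameters which tend to infinity with $N$ in such a way that $a\sim a_1N$ and $b\sim b_1N$ (that is, $a/N\to a_1$ and $b/N\to b_1$). Let $J_k=S_k(a,b)/S_0(a,b)$, where $$S_k(a,b)=\frac{1}{N!}\int_{[0,1]^N}x_1^k\Bigl(\prod_{1\le i<j\le N}(x_i-x_j)^2\Bigr)\prod_{i=1}^N x_i^{a-1}(1-x_i)^{b-1}\,dx_i .$$ Then $$\lim_{N\to\infty}J_k=\sum_{m=0}^{k-1}(-1)^{k-m-1}\binom{k-1}{m}\left(\frac{a_1}{a_1+b_1+2}\right)^k\left(\frac{a_1+1}{a_1}\right)^{m+1}\cdot\sum_{\ell=0}^{k-m-1}(-1)^\ell\binom{k-m-1}{\ell}\frac{(k+\ell-1)!\,(m+1)!}{(k-1)!\,(m+\ell+1)!}\left(\frac{(a_1+1)(a_1+b_1+1)}{a_1(a_1+b_1+2)}\right)^\ell .$$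
   Context: For a positive integer $N$, real numbers $a,b>0$ and an integer $k\ge 0$, the integral $S_k(a,b)$ (which also depends on $N$) is taken over the unit cube $[0,1]^N$ in the variables $x_1,\dots,x_N$; $S_0(a,b)$ is the same integral with $k=0$ (a Selberg integral). Convention for $a_1=0$: in the right-hand side of the formula, the total power of $a_1$ in the $(m,\ell)$ summand is $a_1^{k-m-1-\ell}$, with non-negative exponent since $\ell\le k-m-1$. After this cancellation of powers of $a_1$ the expression makes sense also for $a_1=0$ (with $0^0=1$), and it is to be read in this way. *)

(* Defs.v *)
From HB Require Import structures.
From mathcomp Require Import all_boot all_order all_algebra.
From mathcomp Require Import all_classical all_reals all_analysis.
From mathcomp Require Import measurable_realfun zify ring.
Set Implicit Arguments. Unset Strict Implicit. Unset Printing Implicit Defensive.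
Import Order.TTheory GRing.Theory Num.Theory numFieldNormedType.Exports.
Local Open Scope classical_set_scope.
Local Open Scope ring_scope.

(* lebesgue_measure lives on measurableTypeR R, which has the same carrier and
   the same measurable sets as R but a different display. *)
Definition cons_pair (R : realType) (n : nat)
  (p : measurableTypeR R * n.-tuple R) : n.+1.-tuple R := [tuple of p.1 :: p.2].

Lemma measurable_cons_pair (R : realType) (n : nat) :
  measurable_fun [set: measurableTypeR R * n.-tuple R] (@cons_pair R n).
Proof.
apply: (@measurable_cons _ _ _ R fst n snd).
- exact: (@measurable_fst _ _ (measurableTypeR R) (n.-tuple R)).
- exact: measurable_snd.
Qed.

(* n-dimensional Lebesgue measure, on the product sigma-algebra of n.-tuple R;
   lebesgue_tuple_box computes it on boxes. *)
Fixpoint lebesgue_tuple (R : realType) (n : nat) : set (n.-tuple R) -> \bar R :=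
  match n return set (n.-tuple R) -> \bar R with
  | 0 => \d_ [tuple]
  | m.+1 => pushforward (lebesgue_measure \x @lebesgue_tuple R m)%E
              (@cons_pair R m)
  end.

Section pushforward_product.
Local Open Scope ereal_scope.
Context d1 d2 d3 (T1 : measurableType d1) (T2 : measurableType d2)
  (T3 : measurableType d3) (R : realType).
Variables (m1 : {sigma_finite_measure set T1 -> \bar R}).
Variables (m2 : {sigma_finite_measure set T2 -> \bar R}).
Variables (f : T1 * T2 -> T3) (g : T3 -> T1 * T2).
Hypotheses (mf : measurable_fun [set: T1 * T2] f).
Hypotheses (mg : measurable_fun [set: T3] g) (fK : cancel f g).

Let mu : {measure set _ -> \bar R} := m1 \x m2.

Let nu := pushforward mu f.

Let nu0 : nu set0 = 0.
Proof. by rewrite /nu /pushforward preimage_set0 measure0. Qed.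

Let nu_ge0 A : 0 <= nu A.
Proof. exact: measure_ge0. Qed.

Let nu_sigma_additive : semi_sigma_additive nu.
Proof.
pose mfM := isMeasurableFun.Build _ _ _ _ _ mf.
pose F : {mfun (T1 * T2)%type >-> T3} := HB.pack f mfM.
exact: (@measure_semi_sigma_additive _ _ _ (pushforward mu F)).
Qed.

HB.instance Definition _ := isMeasure.Build _ _ _ nu
  nu0 nu_ge0 nu_sigma_additive.

Let nu_sigma_finite : sigma_finite setT nu.
Proof.
have /sigma_finiteP[F [FT ndF Foo]] := sigma_finiteT m1.
have /sigma_finiteP[G [GT ndG Goo]] := sigma_finiteT m2.
exists (fun k => g @^-1` (F k `*` G k)).
  rewrite -preimage_bigcup (_ : \bigcup_k _ = setT) ?preimage_setT//.
  rewrite -subTset => -[x y] _.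
  have [n _ Fnx] : (\bigcup_k F k) x by rewrite -FT.
  have [k _ Gky] : (\bigcup_k G k) y by rewrite -GT.
  exists (maxn n k) => //; split.
  - by move: x Fnx; exact/subsetPset/ndF/leq_maxl.
  - by move: y Gky; exact/subsetPset/ndG/leq_maxr.
move=> k; have [mF Fk] := Foo k; have [mG Gk] := Goo k; split.
  by rewrite -[X in measurable X]setTI; apply: mg => //; exact: measurableX.
rewrite /nu /pushforward -comp_preimage (_ : g \o f = id); last exact/funext.
by rewrite preimage_id /= product_measure1E// lte_mul_pinfty// ge0_fin_numE.
Qed.

HB.instance Definition _ :=
  @Measure_isSigmaFinite.Build _ _ _ nu nu_sigma_finite.

Lemma pushforward_product_sigma_finite :
  exists m : {sigma_finite_measure set T3 -> \bar R},
    m = pushforward (m1 \x m2) f :> (set T3 -> \bar R).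
Proof. by exists nu. Qed.

End pushforward_product.

Section lebesgue_tuple_measure.
Local Open Scope ereal_scope.
Variable R : realType.

Definition uncons_pair n (t : n.+1.-tuple R) : measurableTypeR R * n.-tuple R :=
  (thead t, [tuple of behead t]).

Lemma measurable_uncons_pair n :
  measurable_fun [set: n.+1.-tuple R] (@uncons_pair n).
Proof.
apply: (@measurable_fun_pair _ _ _ _ (measurableTypeR R) (n.-tuple R)).
- exact: (@measurable_tnth _ R n.+1 ord0).
- exact: measurable_behead.
Qed.

Lemma cons_pairK n : cancel (@cons_pair R n) (@uncons_pair n).
Proof. by move=> [x t]; congr pair; apply/val_inj. Qed.

Let lebesgue_tuple_sigma_finite n :
  exists m : {sigma_finite_measure set (n.-tuple R) -> \bar R},
    m = @lebesgue_tuple R n :> (set (n.-tuple R) -> \bar R).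
Proof.
elim: n => [|n [m /= <-]].
  by exists \d_ ([tuple] : 0.-tuple R).
exact: (pushforward_product_sigma_finite lebesgue_measure m
  (@measurable_cons_pair R n) (@measurable_uncons_pair n) (@cons_pairK n)).
Qed.

Section instances.
Variable n : nat.

Let leb0 : @lebesgue_tuple R n set0 = 0.
Proof. by have [m <-] := lebesgue_tuple_sigma_finite n; exact: measure0. Qed.

Let leb_ge0 A : 0 <= @lebesgue_tuple R n A.
Proof. by have [m <-] := lebesgue_tuple_sigma_finite n; exact: measure_ge0. Qed.

Let leb_sigma_additive : semi_sigma_additive (@lebesgue_tuple R n).
Proof.
have [m <-] := lebesgue_tuple_sigma_finite n.
exact: measure_semi_sigma_additive.
Qed.

HB.instance Definition _ := isMeasure.Build _ _ _ (@lebesgue_tuple R n)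
  leb0 leb_ge0 leb_sigma_additive.

Let leb_sigma_finite : sigma_finite setT (@lebesgue_tuple R n).
Proof.
by have [m <-] := lebesgue_tuple_sigma_finite n; exact: sigma_finiteT.
Qed.

HB.instance Definition _ := @Measure_isSigmaFinite.Build _ _ _
  (@lebesgue_tuple R n) leb_sigma_finite.

End instances.

Lemma lebesgue_tuple_box n (A : 'I_n -> set R) :
  (forall i, measurable (A i)) ->
  @lebesgue_tuple R n [set t | forall i, A i (tnth t i)] =
  \prod_(i < n) lebesgue_measure (A i).
Proof.
elim: n A => [|n IHn] A mA.
  rewrite big_ord0 (_ : [set _ | _] = setT) /=; first by rewrite diracT.
  by apply/seteqP; split => // t _ [].
rewrite big_ord_recl -IHn //= /pushforward -product_measure1E//=; last 2 first.
- exact: mA.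
- rewrite (_ : [set _ | _] = \bigcap_(i in [set: 'I_n])
     ((@tnth n R)^~ i @^-1` A (lift ord0 i))); last first.
    by apply/seteqP; split=> t /= h i; [move=> _|]; exact: h.
  apply: fin_bigcap_measurable; first exact: finite_finset.
  move=> i _; rewrite -[X in measurable X]setTI.
  by apply: (@measurable_tnth _ R n i) => //; exact: mA.
congr (product_measure1 _ _ _); apply/seteqP; split => -[x t] /=.
  move=> h; split=> [|i]; first exact: (h ord0).
  by have := h (lift ord0 i); rewrite /cons_pair/= tnthS.
move=> -[hx ht] i; have [j ->|->] := unliftP ord0 i; last exact: hx.
by rewrite /cons_pair/= tnthS; exact: ht.
Qed.

End lebesgue_tuple_measure.

Definition unit_cube (R : realType) (N : nat) : set (N.-tuple R) :=
  [set x | forall i, 0 <= tnth x i <= 1].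

Definition vandermonde_sq (R : realType) (N : nat) (x : N.-tuple R) : R :=
  \prod_(i < N) \prod_(j < N | (i < j)%N) (tnth x i - tnth x j) ^+ 2.

(* The first coordinate is x`_0; for N = 0 this is the dummy value 0.
   For a, b > 0 the integrand is nonnegative with a finite integral, so the
   real-valued integral loses nothing; the value of 0 `^ _ only matters on the
   boundary of the cube, which is a null set. *)
Definition selberg (R : realType) (N k : nat) (a b : R) : R :=
  (N`!)%:R^-1 *
  \int[@lebesgue_tuple R N]_(x in @unit_cube R N)
    (x`_0 ^+ k * vandermonde_sq x *
     \prod_(i < N) (tnth x i `^ (a - 1) * (1 - tnth x i) `^ (b - 1))).

Definition selberg_ratio (R : realType) (N k : nat) (a b : R) : R :=
  selberg N k a b / selberg N 0 a b.

(* The powers of a1 in the (m, l) summand are collected into a1 ^+ (k - m - 1 - l),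
   so that the formula also covers a1 = 0; see selberg_limitE for a1 <> 0. *)
Definition selberg_limit (R : realType) (k : nat) (a1 b1 : R) : R :=
  \sum_(m < k)
    (-1) ^+ (k - m - 1) * ('C(k - 1, m))%:R *
    (1 / (a1 + b1 + 2)) ^+ k * (a1 + 1) ^+ m.+1 *
    \sum_(l < (k - m - 1).+1)
      (-1) ^+ l * ('C(k - m - 1, l))%:R *
      (((k + l - 1)`! * (m.+1)`!)%N%:R / ((k - 1)`! * (m + l + 1)`!)%N%:R) *
      ((a1 + 1) * (a1 + b1 + 1) / (a1 + b1 + 2)) ^+ l *
      a1 ^+ (k - m - 1 - l).

Lemma selberg_limitE (R : realType) (k : nat) (a1 b1 : R) : a1 != 0 ->
  selberg_limit k a1 b1 =
  \sum_(m < k)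
    (-1) ^+ (k - m - 1) * ('C(k - 1, m))%:R *
    (a1 / (a1 + b1 + 2)) ^+ k * ((a1 + 1) / a1) ^+ m.+1 *
    \sum_(l < (k - m - 1).+1)
      (-1) ^+ l * ('C(k - m - 1, l))%:R *
      (((k + l - 1)`! * (m.+1)`!)%N%:R / ((k - 1)`! * (m + l + 1)`!)%N%:R) *
      ((a1 + 1) * (a1 + b1 + 1) / (a1 * (a1 + b1 + 2))) ^+ l.
Proof.
move=> a10; apply: eq_bigr => m _; rewrite !big_distrr; apply: eq_bigr => l _ /=.
have ak : a1 ^+ k = a1 ^+ (k - m - 1 - l) * a1 ^+ m.+1 * a1 ^+ l.
  by rewrite -!exprD; congr (_ ^+ _); have := ltn_ord m; have := ltn_ord l; lia.
set c := _%:R / _; rewrite invfM mul1r; move: (a1 + b1 + 2)^-1 => u.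
rewrite !exprMn !exprVn ak.
have := expf_neq0 m.+1 a10; have := expf_neq0 l a10.
move: (a1 ^+ m.+1) (a1 ^+ l) (a1 ^+ _) c => p q r c q0 p0.
by field; rewrite q0 p0.
Qed.

(* Main.v *)
Require Import Defs.
From HB Require Import structures.
From mathcomp Require Import all_boot all_order all_algebra all_fingroup.
From mathcomp Require Import all_classical all_reals all_analysis.
From mathcomp Require Import measurable_realfun zify ring lra.
Import Order.TTheory GRing.Theory Num.Theory numFieldNormedType.Exports.
Local Open Scope classical_set_scope.
Local Open Scope ring_scope.

(** Expanding both Vandermonde determinants and integrating coordinatewise
    turns [N S_k / S_0] into a sum over [j] of ratios of determinants of Beta
    moments [mu_(i + l_p)], where [l_p = p] except that [l_j = j + k].  Such a
    determinant is, up to a factor depending on each [l_p] separately, a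
    Vandermonde determinant in the [l_p], and only the last [k] values of [j]
    contribute.  This gives the exact formula
      [N k! J_k = \sum_(r < k) (-1)^r 'C(k - 1, r) F(r)],
      [F(r) = (N - r)_k (a + N - 1 - r)_k / (a + b + 2N - 2 - r)_k]
    with rising factorials, i.e. a [(k-1)]-st finite difference, which converges
    to [1/k] times the coefficient of [z^(k-1)] in
      [((1 + z) (a1 + 1 + z) / (a1 + b1 + 2 + z))^k].
    Re-expanding this rational function in the powers of [z / (1 + z)] produces
    the double sum of the statement. *)

(** * Re-expansion of the limiting rational function *)

(** A division-free, homogeneous form of the expansion of [(1 - Y / X) ^- n] truncated after
    [Y ^+ L]. One more factor [X - Y] telescopes the sum by Pascal's rule and leaves only a boundary
    term in [Y ^+ L.+1]. *)
Lemma negative_binomial_trunc (R : comNzRingType) (X Y : R) (n L : nat) :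
  exists c, (X - Y) ^+ n *
      (\sum_(l < L.+1) ('C(n + l - 1, l))%:R * Y ^+ l * X ^+ (L - l)) =
    X ^+ (n + L) + c * Y ^+ L.+1.
Proof.
elim: n => [|n [c IHn]].
  (* For [n = 0], truncated subtraction gives ['C(0, 0) = 1] at [l = 0] and ['C(l - 1, l) = 0] for
     [l > 0], so a single term remains. *)
  exists 0; rewrite expr0 mul1r mul0r addr0 big_ord_recl big1 ?addr0.
    by rewrite bin0 !mul1r subn0.
  by move=> i _; rewrite lift0 add0n subn1 bin_small// !mul0r.
pose T m := \sum_(l < L.+1) ('C(m + l - 1, l))%:R * Y ^+ l * X ^+ (L - l).
have step : (X - Y) * T n.+1 = X * T n - ('C(n + L, L))%:R * Y ^+ L.+1.
  rewrite mulrBl /T !mulr_sumr [X in X - _]big_ord_recl/=.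
  rewrite [X in _ - X]big_ord_recr/=.
  rewrite [X in _ = X - _]big_ord_recl/= !bin0 subnn expr0.
  rewrite opprD addrA (_ : (n.+1 + L - 1 = n + L)%N); last by lia.
  congr (_ - _); last by rewrite exprS; ring.
  rewrite -addrA; congr (_ + _); rewrite -sumrB; apply: eq_bigr => i _.
  rewrite /bump /= add1n !addnS !addSn !subSS !subn0.
  have ->: (L - i = (L - i.+1).+1)%N by have := ltn_ord i; lia.
  rewrite binS natrD !exprS; ring.
exists (c * X - (X - Y) ^+ n * ('C(n + L, L))%:R).
rewrite exprSr -mulrA -/(T n.+1) step mulrBr mulrCA IHn addSn !exprS; ring.
Qed.

Lemma dvdp_Xn_coef (F : fieldType) (n : nat) (p : {poly F}) :
  'X^n %| p -> forall i, (i < n)%N -> p`_i = 0.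
Proof. by case/dvdpP => q -> i ltin; rewrite coefMXn ltin. Qed.

Lemma coprimep_Xn_linear (F : fieldType) (m n : nat) (c : F) :
  c != 0 -> coprimep 'X^n ((c%:P + 'X) ^+ m).
Proof.
move=> c0; apply/coprimep_expl/coprimep_expr.
by rewrite coprimep_sym coprimepX rootE !hornerE.
Qed.

(** Substituting [q = k - m - 1 - l] turns the index set into the triangle [q + l < k], the shape of
    a truncated product of two series. *)
Lemma sum_antidiagonal (V : nmodType) (k : nat) (G : nat -> nat -> V) :
  \sum_(m < k) \sum_(l < (k - m - 1).+1) G (k - m - 1 - l)%N l =
  \sum_(l < k) \sum_(q < k - l) G q l.
Proof.
rewrite (reindex_inj rev_ord_inj)/=.
rewrite (eq_bigr (fun m : 'I_k => \sum_(0 <= l < m.+1) G (m - l)%N l));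
  last first.
  move=> m _; rewrite big_mkord.
  by have -> : (k - (k - m.+1) - 1 = m)%N by have := ltn_ord m; lia.
rewrite -(big_mkord xpredT (fun m => \sum_(0 <= l < m.+1) G (m - l)%N l)).
rewrite -(big_mkord xpredT (fun l => \sum_(q < k - l) G q l)).
rewrite big_nat; under eq_bigr => m mk.
  by rewrite (big_nat_widen 0 m.+1 k)//; over.
rewrite -big_nat (exchange_big_dep_nat xpredT)//= big_nat [RHS]big_nat.
apply: eq_bigr => l /andP[_ lk].
rewrite (eq_bigl (fun i => xpredT i && (l <= i)%N))// -big_nat_widenl//.
rewrite -{1}(add0n l) big_addn big_mkord; apply: eq_bigr => i _.
by rewrite addnK.
Qed.

Lemma dvdp_bigsum (F : fieldType) (I : Type) (r : seq I) (P : pred I)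
    (f : I -> {poly F}) (p : {poly F}) :
  (forall i, P i -> p %| f i) -> p %| \sum_(i <- r | P i) f i.
Proof.
by move=> pf; apply: (big_ind (fun q => p %| q)) => // x y; exact: dvdp_add.
Qed.

(* With [w = 'X / (1 + 'X)], this is the truncation of
   [(1 + 'X)^k (a + 1 - a w)^k (c + 1 - c w)^-k] at order [w^k]. *)
Definition moment_poly (F : fieldType) (k : nat) (a c : F) : {poly F} :=
  \sum_(m < k) \sum_(l < (k - m - 1).+1)
   (('C(k, k - m - 1 - l))%:R * (a + 1) ^+ (m + l).+1 *
     (- a) ^+ (k - m - 1 - l) *
     ('C(k + l - 1, l))%:R * c ^+ l / (c + 1) ^+ (k + l))
     *: ('X ^+ (k - m - 1) * (1 + 'X) ^+ m.+1).

(** Write [a + 1 + 'X] as [(a + 1) (1 + 'X) - a 'X], and likewise with [c]. The [k]-th power of the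
    first has the binomial terms [f q]; the inverse [k]-th power of the second has, up to a common
    factor, the truncated expansion [g l]. Multiplying by [(c + 1) ^+ (2 * k - 1) * (1 + 'X) ^+
    k.-1], a unit modulo ['X^k], clears the denominators. *)
Lemma moment_poly_congr (F : fieldType) (k : nat) (a c : F) :
  (0 < k)%N -> c + 1 != 0 ->
  'X^k %| ((c + 1)%:P + 'X) ^+ k * moment_poly F k a c -
    ((1 + 'X) * ((a + 1)%:P + 'X)) ^+ k.
Proof.
move=> k0 c1.
pose f q : {poly F} :=
  ((a + 1)%:P * (1 + 'X)) ^+ (k - q) * ((- a)%:P * 'X) ^+ q *+ 'C(k, q).
pose g l : {poly F} := ('C(k + l - 1, l))%:R * (c%:P * 'X) ^+ l *
  ((c + 1)%:P * (1 + 'X)) ^+ (k.-1 - l).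
have cc : ((c + 1) ^+ (2 * k - 1))%:P != 0 :> {poly F}.
  by rewrite polyC_eq0 expf_neq0.
have E : moment_poly F k a c * (1 + 'X) ^+ k.-1 * ((c + 1) ^+ (2 * k - 1))%:P =
    \sum_(l < k) \sum_(q < k - l) f q * g l.
  rewrite -(sum_antidiagonal _ k (fun q l => f q * g l)) /moment_poly.
  rewrite !mulr_suml; apply: eq_bigr => m _; rewrite !mulr_suml.
  apply: eq_bigr => l _; have lm := ltn_ord l; have mk := ltn_ord m.
  rewrite /f /g -mul_polyC.
  have -> : (k - (k - m - 1 - l) = (m + l).+1)%N by lia.
  have e1 : (k.-1 = (m + l) + (k.-1 - l - m))%N by lia.
  have e2 : (2 * k - 1 = (k + l) + (k.-1 - l))%N by lia.
  set q := (k - m - 1 - l)%N.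
  have eX : 'X ^+ (k - m - 1) = 'X ^+ q * 'X ^+ l :> {poly F}.
    by rewrite -exprD; congr (_ ^+ _); rewrite /q; lia.
  have eU : (1 + 'X) ^+ m.+1 * (1 + 'X) ^+ k.-1 =
      (1 + 'X) ^+ (m + l).+1 * (1 + 'X) ^+ (k.-1 - l) :> {poly F}.
    by rewrite -!exprD; congr (_ ^+ _); lia.
  have eC : (c + 1) ^+ (2 * k - 1) = (c + 1) ^+ (k + l) * (c + 1) ^+ (k.-1 - l).
    by rewrite -exprD -e2.
  have cl : (c + 1) ^+ (k + l) != 0 by rewrite expf_neq0.
  transitivity ((('C(k, q))%:R * (a + 1) ^+ (m + l).+1 * (- a) ^+ q *
      ('C(k + l - 1, l))%:R * c ^+ l * (c + 1) ^+ (k.-1 - l))%:P *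
      (('X ^+ q * 'X ^+ l) *
       ((1 + 'X) ^+ (m + l).+1 * (1 + 'X) ^+ (k.-1 - l)))).
    rewrite -eX -eU [X in _ = X * _](_ : _ =
      ('C(k, q)%:R * (a + 1) ^+ (m + l).+1 * (- a) ^+ q *
       'C(k + l - 1, l)%:R * c ^+ l / (c + 1) ^+ (k + l) *
       ((c + 1) ^+ (k + l) * (c + 1) ^+ (k.-1 - l)))%:P).
      by rewrite eC !polyCM; ring.
    by congr polyC; field.
  rewrite -mulr_natr -!polyC_natr !exprMn -!polyC_exp !polyCM; ring.
have Hf : \sum_(q < k.+1) f q = ((a + 1)%:P + 'X) ^+ k.
  rewrite /f -exprDn; congr (_ ^+ _); rewrite !polyCD !polyCN polyC1; ring.
have [d Hg] := negative_binomial_trunc _ ((c + 1)%:P * (1 + 'X))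
   (c%:P * 'X : {poly F}) k k.-1.
rewrite prednK// in Hg.
have XY : (c + 1)%:P * (1 + 'X) - c%:P * 'X = (c + 1)%:P + 'X :> {poly F}.
  rewrite !polyCD polyC1; ring.
rewrite XY in Hg.
(* The products [f q * g l] outside the triangle have [q + l >= k], hence contain ['X^k]. *)
have Hdvd : 'X^k %| (\sum_(q < k.+1) f q) * (\sum_(l < k) g l) -
    \sum_(l < k) \sum_(q < k - l) f q * g l.
  rewrite mulr_sumr -sumrB; apply: dvdp_bigsum => l _.
  rewrite mulr_suml -(big_mkord xpredT (fun q => f q * g l)).
  rewrite (@big_cat_nat _ _ _ (k - l)) ?leqW ?leq_subr//= big_mkord addrAC
    subrr add0r.
  rewrite big_nat; apply: dvdp_bigsum => q /andP[kq qk].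
  apply: (@dvdp_trans _ ('X ^+ (q + l))); first by apply: dvdp_exp2l; lia.
  rewrite /f /g !exprMn -mulr_natr exprD.
  set u := (X in _ %| X).
  have -> : u = ('X ^+ q * 'X ^+ l) * (((a + 1)%:P * (1 + 'X)) ^+ (k - q) *
     (- a)%:P ^+ q * 'C(k, q)%:R * ('C(k + l - 1, l)%:R * c%:P ^+ l *
     (((c + 1)%:P * (1 + 'X)) ^+ (k.-1 - l)))).
    by rewrite /u !exprMn; ring.
  exact: dvdp_mulr.
have cp : coprimep ('X^k : {poly F}) (((c + 1) ^+ (2 * k - 1))%:P *
  (1%:P + 'X) ^+ k.-1).
  by rewrite mul_polyC coprimepZr ?expf_neq0// coprimep_Xn_linear ?oner_eq0.
rewrite -(Gauss_dvdpl _ cp).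
set S := \sum_(l < k) \sum_(q < k - l) f q * g l in E Hdvd.
set T := \sum_(l < k) g l in Hdvd.
(* The full product of the two expansions is inserted: the first summand is the error of the
   triangular truncation, the second that of the negative binomial series. *)
have -> : (((c + 1)%:P + 'X) ^+ k * moment_poly F k a c -
    ((1 + 'X) * ((a + 1)%:P + 'X)) ^+ k) *
    (((c + 1) ^+ (2 * k - 1))%:P * (1%:P + 'X) ^+ k.-1) =
  - ((c + 1)%:P + 'X) ^+ k * (((a + 1)%:P + 'X) ^+ k * T - S) +
  ((a + 1)%:P + 'X) ^+ k * ((((c + 1)%:P + 'X) ^+ k) * T -
    ((c + 1)%:P * (1 + 'X)) ^+ (k + k.-1)).
  have e : (2 * k - 1 = k + k.-1)%N by lia.
  rewrite -E polyC1 !exprMn e rmorphXn !exprD/=.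
  ring.
apply: dvdp_add; first by apply: dvdp_mull; rewrite -Hf.
apply: dvdp_mull; rewrite /T /g Hg addrAC subrr add0r exprMn mulrA.
exact: dvdp_mull.
Qed.

(** The factor ['X ^+ (k - m - 1)] leaves the coefficient of degree [m] in [(1 + 'X) ^+ m.+1], which
    is [m.+1]. *)
Lemma coef_moment_poly (F : fieldType) (k : nat) (a c : F) :
  (moment_poly F k a c)`_k.-1 =
   \sum_(m < k) \sum_(l < (k - m - 1).+1)
   (('C(k, k - m - 1 - l))%:R * (a + 1) ^+ (m + l).+1 *
     (- a) ^+ (k - m - 1 - l) *
     ('C(k + l - 1, l))%:R * c ^+ l / (c + 1) ^+ (k + l)) * m.+1%:R.
Proof.
rewrite /moment_poly coef_sum; apply: eq_bigr => m _; rewrite coef_sum.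
apply: eq_bigr => l _; rewrite coefZ mulrC -['X^_ * _]mulrC coefMXn.
rewrite ifF; last by have := ltn_ord m; lia.
have -> : (k.-1 - (k - m - 1) = m)%N by have := ltn_ord m; lia.
rewrite exprDn coef_sum (bigD1 (inord m))//= big1 ?addr0.
  by rewrite inordK ?ltnS ?leqnSn// expr1n mul1r coefMn coefXn eqxx binSn mulrC.
move=> i im; rewrite expr1n mul1r coefMn coefXn.
case: eqP => [mi|_]; last by rewrite mul0rn.
by case/eqP: im; apply/val_inj; rewrite /= inordK ?ltnS ?leqnSn// -mi.
Qed.

(** * Finite differences in the scaling limit *)

(** With this sign the differences act on functions of [y - r] as discrete derivatives in [y]. *)
Fixpoint backward_diff (R : zmodType) (j : nat) (f : nat -> R) (r : nat) : R :=
  if j is i.+1 then backward_diff R i f r - backward_diff R i f r.+1 else f r.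
Arguments backward_diff {R}.

Lemma backward_diffS (R : zmodType) (j : nat) (f : nat -> R) (r : nat) :
  backward_diff j.+1 f r = backward_diff j f r - backward_diff j f r.+1.
Proof. by []. Qed.

(** Discrete Leibniz rule. The induction combines Pascal's rule with
    [u v - u' v' = u (v - v') + (u - u') v'], whose last factor causes the shift in [g]. *)
Lemma backward_diffM (R : comPzRingType) (f g : nat -> R) (n r : nat) :
  backward_diff n (fun i => f i * g i) r =
  \sum_(i < n.+1) 'C(n, i)%:R *
    (backward_diff i f r * backward_diff (n - i) g (r + i)%N).
Proof.
elim: n r => [|n IHn] r; first by rewrite big_ord1 mul1r addn0.
rewrite /= !IHn -sumrB.
pose u i := backward_diff i f r * backward_diff (n.+1 - i) g (r + i).
transitivity (\sum_(i < n.+1) 'C(n, i)%:R * u i +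
    \sum_(i < n.+1) 'C(n, i)%:R * u i.+1).
  rewrite -big_split/=; apply: eq_bigr => i _.
  rewrite /u subSS subSn -1?ltnS//= addSn addnS; ring.
rewrite [in RHS]big_ord_recl/= [X in X + _ = _]big_ord_recl/= !bin0 -addrA.
congr (_ + _).
have -> : \sum_(i < n) 'C(n, bump 0 i)%:R * u (bump 0 i) =
    \sum_(i < n.+1) 'C(n, i.+1)%:R * u i.+1.
  by rewrite big_ord_recr/= bin_small// mul0r addr0.
by rewrite -big_split/=; apply: eq_bigr => i _;
  rewrite /bump add1n binS natrD mulrDl.
Qed.

Lemma backward_diff_sum (R : comPzRingType) (f : nat -> R) (n r : nat) :
  backward_diff n f r = \sum_(i < n.+1) (-1) ^+ i * 'C(n, i)%:R * f (r + i)%N.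
Proof.
elim: n r => [|n IHn] r; first by rewrite big_ord1 !mul1r addn0.
rewrite /= !IHn.
rewrite [in RHS]big_ord_recl/= [X in X - _]big_ord_recl/= !bin0 -addrA.
congr (_ + _).
have -> :
    \sum_(i < n) (-1) ^+ bump 0 i * 'C(n, bump 0 i)%:R * f (r + bump 0 i)%N =
    \sum_(i < n.+1) (-1) ^+ i.+1 * 'C(n, i.+1)%:R * f (r + i.+1)%N.
  by rewrite big_ord_recr/= bin_small// mulr0 mul0r addr0.
rewrite -sumrB; apply: eq_bigr => i _.
rewrite /bump add1n binS natrD addSn addnS exprS; ring.
Qed.

(** The products at [r] and [r.+1] differ only in their end factors [1 / (y - r)] and
    [1 / (y - r - j - 1)], whose difference supplies [- (j + 1)]. *)
Lemma backward_diff_inv (R : fieldType) (y : R) (j r : nat) :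
  (forall i, (i <= j)%N -> y - (r + i)%:R != 0) ->
  backward_diff j (fun r => (y - r%:R)^-1) r =
  (-1) ^+ j * j`!%:R * \prod_(i < j.+1) (y - (r + i)%:R)^-1.
Proof.
elim: j r => [|j IHj] r y0; first by rewrite big_ord1 addn0 !mul1r.
rewrite /= !IHj; last 2 first.
- by move=> i ij; rewrite addSnnS; exact: y0.
- by move=> i ij; apply: y0; rewrite leqW.
rewrite [X in _ - _ * X = _]big_ord_recr/= [in LHS]big_ord_recl/=.
rewrite [in RHS]big_ord_recl/= [in RHS]big_ord_recr/=.
set P := \prod_(i < j) (y - (r.+1 + i)%:R)^-1.
have sh : \prod_(i < j) (y - (r + bump 0 i)%:R)^-1 = P.
  by apply: eq_bigr => i _; rewrite /bump add1n addnS.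
rewrite !sh.
have := y0 0%N isT; have := y0 j.+1 (leqnn _).
rewrite /bump/= !add1n !addnS !addSn addn0 factS natrM -!natr1 natrD => a0 b0.
rewrite exprS; field. by rewrite a0 b0.
Qed.

(* [f N r] behaves like [h (1 - r / N)] with Taylor expansion [p] of [h] at
   the limit point, up to degree [K]: each backward difference brings a
   factor [1 / N] and a derivative. *)
Definition taylor_profile (R : realType) (K : nat) (f : nat -> nat -> R)
    (p : {poly R}) :=
  forall j r, (j < K)%N ->
    N%:R ^+ j * backward_diff j (f N) r @[N --> \oo] --> p`_j * j`!%:R.

Lemma taylor_profile1 (R : realType) (K : nat) :
  taylor_profile R K (fun _ _ => 1) 1.
Proof.
have D1 j r : backward_diff j.+1 (fun _ => 1 : R) r = 0.
  by elim: j r => [|j IH] r; rewrite backward_diffS ?IH subrr.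
move=> [|j] r _; rewrite coef1.
  by under eq_fun do rewrite expr0 mulr1; rewrite mulr1; exact: cvg_cst.
by under eq_fun do rewrite D1 mulr0; rewrite /= mul0r; exact: cvg_cst.
Qed.

(** In the Leibniz rule [N ^+ j] splits as [N ^+ i * N ^+ (j - i)], and ['C(j, i)] trades [j!] for
    [i! (j - i)!], which leaves the Cauchy product of coefficients. The shift [r + i] is harmless
    because a profile holds at every fixed [r]. *)
Lemma taylor_profileM (R : realType) (K : nat) (f g : nat -> nat -> R)
    (p q : {poly R}) :
  taylor_profile R K f p -> taylor_profile R K g q ->
  taylor_profile R K (fun N r => f N r * g N r) (p * q).
Proof.
move=> fp gq j r jK.
under eq_fun do rewrite backward_diffM mulr_sumr.
rewrite coefM mulr_suml; apply: cvg_big => [|i _]; first exact: add_continuous.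
have ij : (i <= j)%N by rewrite -ltnS.
have -> : p`_i * q`_(j - i) * j`!%:R =
    'C(j, i)%:R * ((p`_i * i`!%:R) * (q`_(j - i) * (j - i)`!%:R)).
  rewrite -(bin_fact ij) !natrM; ring.
have e : (fun N => N%:R ^+ j * ('C(j, i)%:R * (backward_diff i (f N) r *
      backward_diff (j - i) (g N) (r + i)%N))) =
    (fun N => 'C(j, i)%:R * ((N%:R ^+ i * backward_diff i (f N) r) *
      (N%:R ^+ (j - i) * backward_diff (j - i) (g N) (r + i)%N))) :> (nat -> R).
  apply/funext => N.
  have -> : N%:R ^+ j = N%:R ^+ i * N%:R ^+ (j - i) :> R.
    by rewrite -exprD subnKC.
  ring.
rewrite e; apply: cvgM; first exact: cvg_cst.
by apply: cvgM; [apply: fp|apply: gq]; lia.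
Qed.

Lemma taylor_profile_prod (R : realType) (K k : nat)
    (f : nat -> nat -> nat -> R) (p : {poly R}) :
  (forall s, taylor_profile R K (f s) p) ->
  taylor_profile R K (fun N r => \prod_(s < k) f s N r) (p ^+ k).
Proof.
move=> fp; elim: k => [|k IHk].
  rewrite expr0 [X in taylor_profile _ _ X](_ : _ = (fun _ _ => 1)).
    exact: taylor_profile1.
  by apply/funext => N; apply/funext => r; rewrite big_ord0.
rewrite exprSr [X in taylor_profile _ _ X](_ : _ =
  (fun N r => \prod_(s < k) f s N r * f k N r)); first exact: taylor_profileM.
by apply/funext => N; apply/funext => r; rewrite big_ord_recr.
Qed.

Lemma cvg_addr_div (R : realType) (x : nat -> R) (l c : R) :
  x N / N%:R @[N --> \oo] --> l -> (x N + c) / N%:R @[N --> \oo] --> l.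
Proof.
move=> xl; under eq_fun do rewrite mulrDl.
rewrite -[l]addr0; apply: cvgD => //.
rewrite -[X in _ --> X](mulr0 c); apply: cvgM; first exact: cvg_cst.
by rewrite -(cvg_shiftS (fun N => N%:R^-1 : R)); exact: cvg_harmonic.
Qed.

(** The first difference is exactly [1 / N] and all higher ones vanish. *)
Lemma taylor_profile_linear (R : realType) (K : nat) (x : nat -> R) (l : R) :
  x N / N%:R @[N --> \oo] --> l ->
  taylor_profile R K (fun N r => (x N - r%:R) / N%:R) (l%:P + 'X).
Proof.
move=> xl j r _.
have D1 N r' : backward_diff 1 (fun r => (x N - r%:R) / N%:R) r' = N%:R^-1.
  by rewrite /= -mulrBl -natr1; ring.
have D2 i N r' : backward_diff i.+2 (fun r => (x N - r%:R) / N%:R) r' = 0.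
  by elim: i r' => [|i IH] r'; rewrite backward_diffS ?D1 ?IH subrr.
rewrite coefD coefC coefX; case: j => [|[|j]].
- by rewrite addr0 mulr1; under eq_fun do rewrite expr0 mul1r;
  exact: cvg_addr_div.
- rewrite add0r mulr1; under eq_fun do rewrite D1 expr1.
  apply: cvg_near_cst; near=> N; rewrite divff// pnatr_eq0 -lt0n.
  by near: N; exact: nbhs_infty_gt.
- under eq_fun do rewrite D2 mulr0.
  by rewrite addr0 mul0r; exact: cvg_cst.
Unshelve. all: by end_near. Qed.

(** The Taylor polynomial of [1 / (l + 'X)] at [0], in degrees below [K]. *)
Definition inv_linear_poly (F : fieldType) (K : nat) (l : F) : {poly F} :=
  \poly_(j < K) ((-1) ^+ j * l^-1 ^+ j.+1).

Lemma inv_linear_polyE (F : fieldType) (K : nat) (l : F) : l != 0 ->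
  'X^K %| (l%:P + 'X) * inv_linear_poly F K l - 1.
Proof.
move=> l0; have -> : (l%:P + 'X) * inv_linear_poly F K l - 1 =
   - ((-1) ^+ K * l^-1 ^+ K) *: 'X^K; last by rewrite -mul_polyC dvdp_mull.
elim: K => [|K IHK].
  by rewrite /inv_linear_poly poly_def big_ord0 mulr0 sub0r !mulr1 scaleN1r.
have -> : inv_linear_poly F K.+1 l =
    inv_linear_poly F K l + ((-1) ^+ K * l^-1 ^+ K.+1) *: 'X^K.
  by rewrite /inv_linear_poly !poly_def big_ord_recr.
rewrite mulrDr addrAC IHK -!mul_polyC mulrDl mulrA -polyCM exprS.
rewrite (_ : l * _ = (-1) ^+ K * l^-1 ^+ K); last by field.
rewrite polyCN mulrCA -exprS addrA mulNr addNr add0r.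
by rewrite -exprS; congr (_%:P * _);
  rewrite [(-1) ^+ K.+1]exprS mulN1r mulNr opprK.
Qed.

(** The [j.+1] inverse factors of [backward_diff_inv] absorb [N ^+ j] together with the numerator
    [N], and each resulting quotient tends to [l^-1]. *)
Lemma taylor_profile_inv (R : realType) (K : nat) (x : nat -> R) (l : R) :
  0 < l -> x N / N%:R @[N --> \oo] --> l ->
  taylor_profile R K (fun N r => N%:R / (x N - r%:R)) (inv_linear_poly R K l).
Proof.
move=> l0 xl j r jK.
rewrite coef_poly jK.
have cv : \prod_(i < j.+1) (N%:R / (x N - (r + i)%:R)) @[N --> \oo] -->
    \prod_(i < j.+1) l^-1.
  apply: cvg_big => //; first exact: mul_continuous.
  move=> i _; under eq_fun do rewrite -invf_div.
  by apply: (cvgV (f := fun N => (x N - (r + i)%:R) / N%:R));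
    [rewrite gt_eqF|exact: cvg_addr_div].
have lim : (-1) ^+ j * j`!%:R * \prod_(i < j.+1) (N%:R / (x N - (r + i)%:R))
    @[N --> \oo] --> (-1) ^+ j * l^-1 ^+ j.+1 * j`!%:R.
  rewrite mulrAC; apply: cvgM; first exact: cvg_cst.
  by rewrite prodr_const card_ord in cv.
apply: cvg_trans lim; apply: near_eq_cvg.
(* Since [l > 0], eventually [x N > r + j], so no denominator entering the differences vanishes. *)
have xr : \forall N \near \oo, 0 < (x N - (r + j)%:R) / N%:R.
  by apply: (cvgr_gt l) => //; exact: cvg_addr_div.
near=> N.
have N0 : (0 < N)%N by near: N; exact: nbhs_infty_gt.
have xN : r%:R + j%:R < x N.
  rewrite -natrD -subr_gt0 -(@pmulr_lgt0 _ N%:R^-1) ?invr_gt0 ?ltr0n//.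
  by near: N.
have D : backward_diff j (fun r0 : nat => N%:R / (x N - r0%:R)) r =
   N%:R * backward_diff j (fun r0 => (x N - r0%:R)^-1) r.
  by elim: (j) (r) => //= i IH r'; rewrite !IH mulrBr.
rewrite D backward_diff_inv.
  rewrite big_split/= prodr_const card_ord exprS; ring.
move=> i ij; rewrite gt_eqF// subr_gt0 (le_lt_trans _ xN)// -natrD ler_nat; lia.
Unshelve. all: by end_near. Qed.

(** * Determinants of Beta moments *)

Lemma det_horner (R : comNzRingType) (n : nat) (p : 'I_n -> {poly R})
    (x : 'I_n -> R) : (forall i, (size (p i) <= n)%N) ->
  \det (\matrix_(i, j) (p i).[x j]) =
  \det (\matrix_(i, j < n) (p i)`_j) * \det (Vandermonde n (\row_j x j)).
Proof.
move=> sp; rewrite -det_mulmx; congr (\det _); apply/matrixP => i j.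
rewrite !mxE (horner_coef_wide _ (sp i)); apply: eq_bigr => l _.
by rewrite !mxE.
Qed.

(** Only pairs of nodes containing [j] change, and in either order of the pair the correction is the
    same quotient [u i], the two signs cancelling. *)
Lemma det_Vandermonde_update (F : fieldType) (n : nat) (x : 'I_n -> F)
    (j : 'I_n) (y : F) : injective x ->
  \det (Vandermonde n (\row_i (if i == j then y else x i))) =
  \det (Vandermonde n (\row_i x i)) *
    \prod_(i | i != j) ((y - x i) / (x j - x i)).
Proof.
move=> xinj; pose u i := (y - x i) / (x j - x i).
have xne p : p != j -> x j - x p != 0.
  by move=> pj; rewrite subr_eq0 eq_sym (inj_eq xinj).
rewrite !det_Vandermonde.
transitivity (\prod_(p < n) \prod_(q < n | (p < q)%N)
    ((x q - x p) * ((if q == j then u p else 1) *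
      (if p == j then u q else 1)))).
  apply: eq_bigr => p _; apply: eq_bigr => q pq; rewrite !mxE /u.
  have [qj|qj] := eqVneq q j; have [pj|pj] := eqVneq p j.
  - by move: pq; rewrite qj pj ltnn.
  - by rewrite mulr1 qj; field; exact: xne.
  - by rewrite mul1r pj; field; exact: xne.
  - by rewrite !mulr1.
transitivity ((\prod_(p < n) \prod_(q < n | (p < q)%N) (x q - x p)) *
   ((\prod_(p < n) \prod_(q < n | (p < q)%N) (if q == j then u p else 1)) *
    (\prod_(p < n) \prod_(q < n | (p < q)%N) (if p == j then u q else 1)))).
  rewrite -!big_split/=; apply: eq_bigr => p _.
  by rewrite -!big_split.
congr (_ * _).
  by apply: eq_bigr => p _; apply: eq_bigr => q _; rewrite !mxE.
rewrite [RHS](bigID (fun i : 'I_n => (i < j)%N))/=; congr (_ * _).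
  rewrite [RHS](eq_bigl (fun i : 'I_n => (i < j)%N)); last first.
    by move=> i; case: (ltngtP i j) => [ij|ij|/val_inj->];
      rewrite ?andbF// andbT -val_eqE neq_ltn ij.
  rewrite [RHS]big_mkcond/=; apply: eq_bigr => p _.
  rewrite -big_mkcondr/=; case: ifP => pj.
    rewrite (big_pred1 j)// => q /=; case: eqP => [->|];
      rewrite ?andbT// andbF//.
  by rewrite big_pred0// => q /=; case: eqP => [->|]; rewrite ?andbT// andbF.
rewrite (bigD1 j)//= [X in _ * X]big1 ?mulr1; last first.
  by move=> i ij; rewrite big1// => q _; rewrite (negbTE ij).
rewrite eqxx; apply: eq_bigl => q.
by rewrite -leqNgt [LHS]ltn_neqAle eq_sym.
Qed.

Definition rising (R : pzRingType) (a : R) (n : nat) : R :=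
  \prod_(s < n) (a + s%:R).
Arguments rising {R}.

Lemma risingD (R : pzRingType) (a : R) (m n : nat) :
  rising a (m + n) = rising a m * rising (a + m%:R) n.
Proof.
rewrite /rising big_split_ord/=; congr (_ * _); apply: eq_bigr => i _.
by rewrite natrD addrA.
Qed.

Lemma rising_gt0 (R : numDomainType) (a : R) (n : nat) :
  0 < a -> 0 < rising a n.
Proof. by move=> a0; rewrite prodr_gt0// => i _; rewrite ltr_wpDr. Qed.

(** For [i < n], its value at [l] is [rising a (i + l) / rising c (i + l)] divided by
    [beta_weight n a c l]: the numerator of row [i] over the denominator [rising c (l + n.-1)]
    common to the whole column. *)
Definition beta_row_poly (R : comNzRingType) (n : nat) (a c : R) (i : nat) :
  {poly R} :=
  \prod_(s < i) ('X + (a + s%:R)%:P) *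
  \prod_(s < n.-1 - i) ('X + (c + i%:R + s%:R)%:P).

Lemma size_beta_row_poly (R : idomainType) (n : nat) (a c : R) (i : nat) :
  (i < n)%N -> (size (beta_row_poly R n a c i) <= n)%N.
Proof.
move=> ltin.
have sz m (f : nat -> R) : size (\prod_(s < m) ('X + (f s)%:P)) = m.+1.
  rewrite (eq_bigr (fun s : 'I_m => ('X - (- f s)%:P)%R)) ?size_prod_XsubC.
    by rewrite /index_enum -enumT size_enum_ord.
  by move=> s _; rewrite polyCN opprK.
rewrite (leq_trans (size_polyMleq _ _))// (sz _ (fun s => a + s%:R)).
rewrite (sz _ (fun s => c + i%:R + s%:R)); lia.
Qed.

Lemma horner_beta_row_poly (R : comNzRingType) (n : nat) (a c : R) (i : nat)
    (y : R) :
  (beta_row_poly R n a c i).[y] =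
    rising (a + y) i * rising (c + y + i%:R) (n.-1 - i).
Proof.
rewrite hornerM !horner_prod; congr (_ * _); apply: eq_bigr => s _;
  rewrite hornerD hornerX hornerC; ring.
Qed.

Definition beta_weight (F : fieldType) (n : nat) (a c : F) (l : nat) : F :=
  rising a l / rising c (l + n.-1).
Arguments beta_weight {F}.

(** Once the weight is taken out of each column, row [i] consists of values of one polynomial of
    degree below [n] at the points [l j], and [det_horner] applies. *)
Lemma det_beta_moments (F : numFieldType) (n : nat) (a c : F)
    (l : 'I_n -> nat) :
  0 < c ->
  \det (\matrix_(i, j) (rising a (i + l j) / rising c (i + l j))) =
  \prod_(j < n) beta_weight n a c (l j) *
  (\det (\matrix_(i, j < n) (beta_row_poly F n a c i)`_j) *
   \det (Vandermonde n (\row_j (l j)%:R))).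
Proof.
move=> c0.
rewrite -(det_horner _ _ (fun i : 'I_n => beta_row_poly F n a c i)); last first.
  by move=> i; exact: size_beta_row_poly.
pose D : 'M[F]_n := diag_mx (\row_j beta_weight n a c (l j)).
have -> : \prod_(j < n) beta_weight n a c (l j) = \det D.
  by rewrite det_diag; apply: eq_bigr => j _; rewrite mxE.
rewrite mulrC -det_mulmx; congr (\det _); apply/matrixP => i j.
rewrite mul_mx_diag !mxE horner_beta_row_poly /beta_weight.
have e : (l j + n.-1 = (l j + i) + (n.-1 - i))%N by have := ltn_ord i; lia.
rewrite [(i + l j)%N]addnC e !risingD natrD addrA.
have := rising_gt0 _ c (l j) c0.
have := rising_gt0 _ (c + (l j)%:R) i (ltr_wpDr (ler0n _ _) c0).
have c1 : 0 < c + (l j)%:R + i%:R by rewrite -addrA -natrD ltr_wpDr.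
have := rising_gt0 _ _ (n.-1 - i) c1.
move=> /lt0r_neq0 h1 /lt0r_neq0 h2 /lt0r_neq0 h3.
by field; rewrite h1 h2 h3.
Qed.

(** By [det_horner] it suffices to find points where the determinant of values is nonzero. At those
    chosen, the diagonal entries are [(-1) ^+ i * i!] times [rising (c - a) (n.-1 - i)]. *)
Lemma det_beta_row_poly_neq0 (F : numFieldType) (n : nat) (a c : F) :
  0 < c - a -> \det (\matrix_(i, j < n) (beta_row_poly F n a c i)`_j) != 0.
Proof.
move=> ca.
(* The values at the points [- a - j] form a triangular matrix. *)
have :
    \det (\matrix_(i < n, j < n) (beta_row_poly F n a c i).[- a - j%:R]) != 0.
  rewrite -det_tr det_trig; last first.
    apply/is_trig_mxP => i j ij; rewrite !mxE horner_beta_row_poly.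
    rewrite /rising (bigD1 (Ordinal ij))//=.
    by rewrite (_ : a + _ + _ = 0) ?mul0r//; ring.
  apply/prodf_neq0 => i _; rewrite !mxE horner_beta_row_poly mulf_neq0//.
    apply/prodf_neq0 => s _.
    rewrite (_ : _ + _ = s%:R - i%:R); last by ring.
    by rewrite subr_eq0 eqr_nat ltn_eqF.
  by rewrite (_ : c + _ + _ = c - a) ?gt_eqF ?rising_gt0//; ring.
rewrite (det_horner _ _ (fun i : 'I_n => beta_row_poly F n a c i)); last first.
  by move=> i; exact: size_beta_row_poly.
by rewrite mulf_eq0 negb_or => /andP[].
Qed.

(** The coefficient determinant is common to both sides; shifting column [j] moves one Vandermonde
    node and changes one weight. *)
Lemma det_beta_moments_shift (F : numFieldType) (n k : nat) (a c : F)
    (j : 'I_n) :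
  0 < a -> 0 < c - a ->
  \det (\matrix_(i, p < n) (rising a (i + (p + k * (p == j))) /
                            rising c (i + (p + k * (p == j))))) =
  \det (\matrix_(i < n, p < n) (rising a (i + p) / rising c (i + p))) *
  (\prod_(i < n | i != j) (((j + k)%:R - i%:R) / (j%:R - i%:R)) *
   (beta_weight n a c (j + k) / beta_weight n a c j)).
Proof.
move=> a0 ca; have c0 : 0 < c by rewrite -(subrK a c) addr_gt0.
rewrite (det_beta_moments _ _ _ _ (fun p : 'I_n => (p + k * (p == j))%N))//.
rewrite (det_beta_moments _ _ _ _ (fun p : 'I_n => p : nat))//.
have inj : injective (fun p : 'I_n => (p : nat)%:R : F).
  by move=> p q /eqP; rewrite eqr_nat => /eqP/val_inj.
have := det_Vandermonde_update _ _ _ j (j + k)%:R inj => /= V.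
rewrite (_ : \row_i _ = \row_p (p + k * (p == j))%:R) in V; last first.
  apply/matrixP => p q; rewrite !mxE; case: eqP => [->|];
    first by rewrite muln1.
  by rewrite muln0 addn0.
rewrite V (bigD1 j)//= eqxx muln1 [in RHS](bigD1 j)//=.
rewrite (eq_bigr (fun p : 'I_n => beta_weight n a c p)); last first.
  by move=> p /negbTE ->; rewrite muln0 addn0.
have w0 : beta_weight n a c j != 0.
  by rewrite mulf_neq0 ?invr_eq0// gt_eqF// rising_gt0.
by field.
Qed.

(** Both sides are ['C(j + k, k)]; the form with [rising] combines with the quotient of weights. *)
Lemma prodr_shift_ratio (F : numFieldType) (j k : nat) :
  \prod_(i < j) (((j + k)%:R - i%:R) / (j%:R - i%:R)) =
  rising j.+1%:R k / k`!%:R :> F.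
Proof.
elim: j => [|j IHj].
  rewrite big_ord0; apply/esym/(canLR (mulfK _));
    first by rewrite pnatr_eq0 -lt0n fact_gt0.
  rewrite mul1r; elim: k => [|k IHk]; first by rewrite /rising big_ord0.
  by rewrite /rising big_ord_recr/= -/(rising 1 k) IHk factS natrM mulrC nat1r.
rewrite big_ord_recl/= !subr0.
rewrite (eq_bigr (fun i : 'I_j => ((j + k)%:R - i%:R) / (j%:R - i%:R)));
  last first.
  move=> i _; congr (_ / _); rewrite /bump add1n ?addSn -!natr1; ring.
rewrite IHj.
(* Both sides are [rising j.+1 k.+1], with its first or its last factor split off. *)
have H : j.+1%:R * rising j.+2%:R k = rising j.+1%:R k * (j.+1 + k)%:R :> F.
  transitivity (rising j.+1%:R k.+1 : F).
    rewrite -[k.+1]add1n risingD natr1; congr (_ * _).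
    by rewrite /rising big_ord_recl big_ord0 mulr1 addr0.
  by rewrite /rising big_ord_recr/= natrD.
have k0 : k`!%:R != 0 :> F by rewrite pnatr_eq0 -lt0n fact_gt0.
have j0 : j.+1%:R != 0 :> F by rewrite pnatr_eq0.
apply: (mulfI j0); rewrite [RHS]mulrA H; field.
by rewrite k0 nat1r j0.
Qed.

Lemma prodr_signed_binomial (F : numFieldType) (m r : nat) :
  \prod_(i < r) ((m%:R - i%:R) / - i.+1%:R) = (-1) ^+ r * 'C(m, r)%:R :> F.
Proof.
elim: r => [|r IHr]; first by rewrite big_ord0 bin0 mulr1.
rewrite big_ord_recr/= IHr exprS.
have r0 : r.+1%:R != 0 :> F by rewrite pnatr_eq0.
have H : r.+1%:R * 'C(m, r.+1)%:R = (m%:R - r%:R) * 'C(m, r)%:R :> F.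
  rewrite -natrM mul_bin_left; have [rm|mr] := leqP r m.
    by rewrite natrM natrB.
  by rewrite !bin_small// muln0 mulr0.
apply: (mulfI r0); rewrite [RHS]mulrCA H; field.
by rewrite nat1r.
Qed.

(** The nodes below [j] give ['C(j + k, k)], the [r] nodes above it the signed binomial coefficient.
    For [r >= k] the moved node [j + k] collides with another one, hence the vanishing. *)
Lemma prodr_hook (F : numFieldType) (k j r : nat) : (0 < k)%N ->
  \prod_(i < (j + r).+1 | i != j :> nat)
    (((j + k)%:R - i%:R) / (j%:R - i%:R)) =
  (-1) ^+ r * 'C(k - 1, r)%:R * (rising j.+1%:R k / k`!%:R) :> F.
Proof.
move=> k0; pose f i : F := ((j + k)%:R - i%:R) / (j%:R - i%:R).
rewrite -(big_mkord (fun i => i != j) f) (@big_cat_nat _ _ _ j)//=; last by lia.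
rewrite mulrC; congr (_ * _); last first.
  rewrite big_nat_cond (eq_bigl (fun i => (0 <= i < j)%N));
    last by move=> i; lia.
  by rewrite -big_nat big_mkord prodr_shift_ratio.
rewrite big_ltn_cond; last by lia.
rewrite eqxx/= big_nat_cond (eq_bigl (fun i => (j.+1 <= i < (j + r).+1)%N));
  last by move=> i; lia.
rewrite -big_nat -{1}(add0n j.+1) big_addn (_ : (_ - _ = r)%N); last by lia.
rewrite big_mkord -prodr_signed_binomial; apply: eq_bigr => i _; rewrite /f.
rewrite natrB// natrD addnS -natr1 natrD -[i.+1%:R]natr1.
by congr (_ / _); ring.
Qed.

Lemma sum_det_beta_moments_shift (F : numFieldType) (n k : nat) (a c : F) :
  (0 < k <= n)%N -> 0 < a -> 0 < c - a ->
  \sum_(j < n) \det (\matrix_(i, p < n) (rising a (i + (p + k * (p == j))) /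
                            rising c (i + (p + k * (p == j))))) =
  \det (\matrix_(i < n, p < n) (rising a (i + p) / rising c (i + p))) *
  \sum_(r < k) (-1) ^+ r * 'C(k - 1, r)%:R *
     ((k`!%:R)^-1 * \prod_(s < k) ((n%:R + s%:R - r%:R) *
      (a + n%:R - 1 + s%:R - r%:R) / (c + n%:R + n%:R - 2 + s%:R - r%:R))).
Proof.
move=> /andP[k0 kn] a0 ca; have c0 : 0 < c by rewrite -(subrK a c) addr_gt0.
under eq_bigr do rewrite det_beta_moments_shift//.
rewrite -mulr_sumr; congr (_ * _).
(* The new index [r = n - 1 - j] counts the nodes above [j]. *)
rewrite (reindex_inj rev_ord_inj)/=.
pose g r : F := (-1) ^+ r * 'C(k - 1, r)%:R *
     ((k`!%:R)^-1 * \prod_(s < k) ((n%:R + s%:R - r%:R) *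
      (a + n%:R - 1 + s%:R - r%:R) / (c + n%:R + n%:R - 2 + s%:R - r%:R))).
rewrite (eq_bigr (fun r : 'I_n => g r)); last first.
  move=> r _; set j := (n - r.+1)%N.
  have nE : n = (j + r).+1 by rewrite /j; have := ltn_ord r; lia.
  rewrite (eq_bigl (fun i : 'I_n => i != j :> nat))//.
  have -> :
      \prod_(i < n | i != j :> nat) (((j + k)%:R - i%:R) / (j%:R - i%:R)) =
    (-1) ^+ r * 'C(k - 1, r)%:R * (rising j.+1%:R k / k`!%:R) :> F.
    by rewrite -prodr_hook// -nE.
  rewrite /g -!mulrA; congr (_ * (_ * _)).
  rewrite mulrCA; congr (_ * _).
  rewrite /beta_weight risingD (_ : j + k + n.-1 = (j + n.-1) + k)%N;
    last by lia.
  rewrite risingD.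
  have p1 := rising_gt0 _ a j a0; have p2 := rising_gt0 _ c (j + n.-1) c0.
  have c1 : 0 < c + (j + n.-1)%:R by rewrite ltr_wpDr.
  have p3 := rising_gt0 _ _ k c1.
  transitivity (rising j.+1%:R k *
    (rising (a + j%:R) k / rising (c + (j + n.-1)%:R) k)).
    by congr (_ * _); field; rewrite !gt_eqF.
  rewrite /rising -prodf_div -big_split/=; apply: eq_bigr => s _.
  have nR : n%:R = j%:R + r%:R + 1 :> F by rewrite -natrD natr1 -nE.
  rewrite mulrA; congr (_ * _ / _).
  - by rewrite nR -natr1; ring.
  - by rewrite nR; ring.
  - rewrite (_ : n.-1 = j + r)%N; last by rewrite [in LHS]nE.
    by rewrite !natrD nR; ring.
(* The range is cut at [k <= n]; beyond it ['C(k - 1, r)] is zero. *)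
rewrite -!(big_mkord xpredT g) (@big_cat_nat _ _ _ k)//= [X in _ + X]big_nat.
by rewrite [X in _ + X]big1 ?addr0// => i /andP[ki _];
  rewrite /g bin_small ?mulr0 ?mul0r//; lia.
Qed.

(** * Beta integrals *)

(** The exponents stand for [a - 1] and [b - 1]. Once [a] and [b] exceed [1] they are positive, and
    the kernel is continuous on the closed interval. *)
Definition beta_kernel (R : realType) (p q x : R) : R := x `^ p * (1 - x) `^ q.
Arguments beta_kernel {R}.

Lemma is_derive_powR_onem (R : realType) (q x : R) : x < 1 ->
  is_derive x 1 (fun y : R => (1 - y) `^ q) (- (q * (1 - x) `^ (q - 1))).
Proof.
move=> x1.
have d1 : is_derive (1 - x) 1 (fun y : R => y `^ q) (q * (1 - x) `^ (q - 1)).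
  by apply: is_derive1_powR; rewrite subr_gt0.
have d2 : is_derive x 1 (fun y : R => 1 - y) (-1).
  by apply: is_derive_eq; rewrite add0r mul1r.
have := is_derive1_comp (f := fun y : R => y `^ q)
  (g := fun y => 1 - y) (x := x) d1 d2.
by rewrite mulrN1.
Qed.

Lemma is_derive_beta_kernel (R : realType) (p q x : R) : 0 < x < 1 ->
  is_derive x 1 (beta_kernel p q)
    (p * beta_kernel (p - 1) q x - q * beta_kernel p (q - 1) x).
Proof.
move=> /andP[x0 x1].
have d1 := is_derive1_powR p x0; have d2 := is_derive_powR_onem R q x x1.
apply: is_derive_eq.
rewrite /beta_kernel /GRing.scale /=; ring.
Qed.

Lemma beta_kernel_LRcontinuous (R : realType) (p q : R) : 0 < p -> 0 < q ->
  derivable_oo_LRcontinuous (beta_kernel p q) 0 1.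
Proof.
move=> p0 q0; split.
- move=> x; rewrite in_itv/= => x01.
  by have /@ex_derive := is_derive_beta_kernel R p q x x01.
- apply: cvgM.
  + by rewrite powR0 ?gt_eqF//; exact: powR_cvg0.
  + apply: cvg_at_right_filter.
    have /@ex_derive/derivable1_diffP/differentiable_continuous :=
      is_derive_powR_onem R q 0 ltr01.
    exact.
- apply: cvgM.
  + apply: cvg_at_left_filter.
    have /@ex_derive/derivable1_diffP/differentiable_continuous :=
      is_derive1_powR p (@ltr01 R).
    exact.
  + rewrite subrr powR0 ?gt_eqF//.
    apply: (cvg_comp (fun y => 1 - y) (fun y => y `^ q) (G := 0^'+));
      last exact: powR_cvg0.
    move=> A [/= e e0 Ae]; exists e => //= y ye y1; apply: Ae;
      rewrite /= ?subr_gt0//.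
    by rewrite sub0r normrN.
Qed.

Lemma within_continuous_beta_kernel (R : realType) (p q : R) : 0 < p -> 0 < q ->
  {within `[0, 1], continuous (beta_kernel p q)}.
Proof.
by move=> p0 q0; apply/derivable_oo_LRcontinuous_within/beta_kernel_LRcontinuous.
Qed.

Lemma integrable_beta_kernel (R : realType) (p q : R) : 0 < p -> 0 < q ->
  lebesgue_measure.-integrable `[0, 1] (EFin \o beta_kernel p q).
Proof.
move=> p0 q0; apply: continuous_compact_integrable;
  first exact: segment_compact.
exact: within_continuous_beta_kernel.
Qed.

Definition beta_integral (R : realType) (p q : R) : R :=
  \int[lebesgue_measure]_(x in `[0, 1]) beta_kernel p q x.
Arguments beta_integral {R}.

Lemma powRS (R : realType) (x p : R) :
  0 <= x -> 0 < p -> x `^ (p + 1) = x * x `^ p.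
Proof.
move=> x0 p0; rewrite powRD ?powRr1 1?mulrC//.
by rewrite gt_eqF// addr_gt0.
Qed.

(** Integration of the derivative of [beta_kernel (p + 1) (q + 1)], which vanishes at both
    endpoints; one factor [1 - x] is expanded to return to the exponent [q]. *)
Lemma beta_integralS (R : realType) (p q : R) : 0 < p -> 0 < q ->
  (p + q + 2) * beta_integral (p + 1) q = (p + 1) * beta_integral p q.
Proof.
move=> p0 q0; have p1 : 0 < p + 1 by rewrite addr_gt0.
have q1 : 0 < q + 1 by rewrite addr_gt0.
pose f x := (p + 1) * beta_kernel p q x - (p + q + 2) * beta_kernel (p + 1) q x.
have fE x : x \in `[0, 1] ->
    f x = (p + 1) * beta_kernel p (q + 1) x - (q + 1) * beta_kernel (p + 1) q x.
  rewrite in_itv/= => /andP[x0 x1].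
  by rewrite /f /beta_kernel !powRS ?subr_ge0//; ring.
have int0 : (\int[lebesgue_measure]_(x in `[0%R, 1%R]) (f x)%:E = 0)%E.
  rewrite (@continuous_FTC2 _ _ (beta_kernel (p + 1) (q + 1)))//.
  - by rewrite /beta_kernel subrr !powR0 ?gt_eqF// mul0r mulr0 subee.
  - move=> x; apply: cvgB; apply: cvgM; try exact: cvg_cst;
      exact: within_continuous_beta_kernel.
  - exact: beta_kernel_LRcontinuous.
  - move=> x; rewrite in_itv/= => x01.
    have d := is_derive_beta_kernel R (p + 1) (q + 1) x x01.
    rewrite derive1E derive_val !addrK fE// in_itv/=.
    by case/andP: x01 => /ltW -> /ltW ->.
have := integrable_beta_kernel R p q p0 q0.
have := integrable_beta_kernel R (p + 1) q p1 q0.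
move=> i1 i2.
apply/esym/eqP; rewrite -subr_eq0; apply/eqP.
rewrite /beta_integral -!RintegralZl// -RintegralB//.
- by rewrite /Rintegral int0.
- apply: continuous_compact_integrable; first exact: segment_compact.
  by move=> x; apply: cvgM;
    [exact: cvg_cst|exact: within_continuous_beta_kernel].
- apply: continuous_compact_integrable; first exact: segment_compact.
  by move=> x; apply: cvgM;
    [exact: cvg_cst|exact: within_continuous_beta_kernel].
Qed.

Lemma beta_kernel_ge0 (R : realType) (p q x : R) : 0 <= beta_kernel p q x.
Proof. by rewrite mulr_ge0// powR_ge0. Qed.

Lemma measurable_beta_kernel (R : realType) (p q : R) :
  measurable_fun [set: R] (beta_kernel p q).
Proof.
apply: measurable_funM; first exact: measurable_powR.
apply: (@measurableT_comp _ _ _ _ _ _ (fun x : R => x `^ q) setT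
  (fun x : R => 1 - x)).
  exact: measurable_powR.
exact: measurable_funB.
Qed.

Lemma beta_integralE (R : realType) (p q : R) : 0 < p -> 0 < q ->
  (\int[lebesgue_measure]_(x in `[0%R, 1%R]) (beta_kernel p q x)%:E =
   (beta_integral p q)%:E)%E.
Proof.
move=> p0 q0; rewrite /beta_integral /Rintegral fineK//.
rewrite -integral_fin_num_abs//;
  last exact: measurable_funTS (measurable_beta_kernel _ _ _).
by have /integrableP[] := integrable_beta_kernel R p q p0 q0.
Qed.

Lemma beta_integral_gt0 (R : realType) (p q : R) : 0 < p -> 0 < q ->
  0 < beta_integral p q.
Proof.
move=> p0 q0; rewrite -lte_fin -beta_integralE//.
(* A lower bound of the kernel on [[1/4, 1/2]], where [x >= 1/4] and [1 - x >= 1/2]. *)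
pose c : R := 4^-1 `^ p * 2^-1 `^ q.
have c0 : 0 < c by rewrite mulr_gt0// powR_gt0// invr_gt0.
have mk D : measurable D -> measurable_fun D (EFin \o @beta_kernel R p q).
  by move=> mD; apply/measurable_EFinP;
    exact: measurable_funTS (measurable_beta_kernel _ _ _).
have sub : (\int[lebesgue_measure]_(x in `[4^-1%R, 2^-1%R]) (cst c%:E x) <=
    \int[lebesgue_measure]_(x in `[0%R, 1%R]) (beta_kernel p q x)%:E)%E.
  apply: (@le_trans _ _ (\int[lebesgue_measure]_(x in `[4^-1%R, 2^-1%R])
    (beta_kernel p q x)%:E)%E).
    apply: ge0_le_integral => //.
    - by move=> x _; rewrite lee_fin ltW.
    - exact: mk.
    - move=> x; rewrite /= in_itv/= => /andP[x1 x2]; rewrite lee_fin.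
      have x0 : 0 <= x by rewrite (le_trans _ x1)// invr_ge0.
      apply: ler_pM; rewrite ?powR_ge0//; apply: ge0_ler_powR;
        rewrite ?nnegrE ?(ltW p0) ?(ltW q0)//; lra.
  apply: ge0_subset_integral => //; first exact: mk.
  - by move=> x _; rewrite lee_fin beta_kernel_ge0.
  - by move=> x /=; rewrite !in_itv/= => /andP[? ?]; apply/andP; split; lra.
apply: lt_le_trans sub; rewrite integral_cst//= lebesgue_measure_itv/= lte_fin.
rewrite ifT; last lra.
by rewrite -EFinB -EFinM lte_fin mulr_gt0//; lra.
Qed.

Lemma beta_integral_rising (R : realType) (a b : R) (n : nat) :
  1 < a -> 1 < b ->
  beta_integral (a - 1 + n%:R) (b - 1) =
  beta_integral (a - 1) (b - 1) * (rising a n / rising (a + b) n).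
Proof.
move=> a1 b1; elim: n => [|n IHn].
  by rewrite addr0 /rising !big_ord0 divr1 mulr1.
have p0 : 0 < a - 1 + n%:R by rewrite ltr_pwDl// subr_gt0.
have q0 : 0 < b - 1 by rewrite subr_gt0.
have := beta_integralS R _ _ p0 q0.
have -> : a - 1 + n%:R + 1 = a - 1 + n.+1%:R by rewrite -natr1; ring.
have -> : a - 1 + n%:R + (b - 1) + 2 = a + b + n%:R by ring.
rewrite IHn /rising !big_ord_recr/= -!/(rising _ _).
have -> : a - 1 + n.+1%:R = a + n%:R by rewrite -natr1; ring.
have ab : 0 < a + b + n%:R by rewrite ltr_pwDl// addr_gt0// (lt_trans ltr01).
have rab : 0 < rising (a + b) n.
  by rewrite rising_gt0// addr_gt0// (lt_trans ltr01).
move=> H; apply: (mulfI (lt0r_neq0 ab)); rewrite H; field.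
by rewrite !gt_eqF.
Qed.

(** Extension by [0] lets a product over the coordinates carry the restriction to the cube, so
    Tonelli applies on the whole space. *)
Definition selberg_factor (R : realType) (a b : R) (n : nat) : R -> R :=
  (fun x => x ^+ n * (x `^ (a - 1) * (1 - x) `^ (b - 1))) \_ `[0, 1].

Lemma selberg_factor_ge0 (R : realType) (a b : R) (n : nat) (x : R) :
  0 <= selberg_factor R a b n x.
Proof.
rewrite /selberg_factor patchE; case: ifPn => //;
  rewrite inE/= in_itv/= => /andP[x0 _].
by rewrite !mulr_ge0// ?powR_ge0// exprn_ge0.
Qed.

Lemma measurable_selberg_factor (R : realType) (a b : R) (n : nat) :
  measurable_fun [set: R] (selberg_factor R a b n).
Proof.
apply/(measurable_restrictT _ _).1 => //; apply: measurable_funTS.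
apply: measurable_funM; first exact: measurable_funX.
exact: (measurable_beta_kernel R (a - 1) (b - 1)).
Qed.

Lemma integral_selberg_factor (R : realType) (a b : R) (n : nat) :
  1 < a -> 1 < b ->
  (\int[lebesgue_measure]_x (selberg_factor R a b n x)%:E =
   (beta_integral (a - 1) (b - 1) * (rising a n / rising (a + b) n))%:E)%E.
Proof.
move=> a1 b1; rewrite -beta_integral_rising//.
have p0 : 0 < a - 1 + n%:R by rewrite ltr_pwDl// subr_gt0.
have q0 : 0 < b - 1 by rewrite subr_gt0.
rewrite -beta_integralE// [RHS]integral_mkcond; apply: eq_integral => x _.
rewrite /selberg_factor !patchE; case: ifPn => //;
  rewrite inE/= in_itv/= => /andP[x0 _].
congr EFin; rewrite /beta_kernel mulrA; congr (_ * _).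
rewrite [x `^ (a - 1 + _)]powRD; last by rewrite (gt_eqF p0).
by rewrite powR_mulrn// mulrC.
Qed.

(** * From the Selberg integral to determinants *)

Lemma measurable_tuple_prod (R : realType) (n : nat) (f : 'I_n -> R -> R) :
  (forall i, measurable_fun [set: R] (f i)) ->
  measurable_fun [set: n.-tuple R] (fun t => \prod_i f i (tnth t i)).
Proof.
move=> mf; apply: measurable_prod => i _.
by apply: measurableT_comp => //; exact: measurable_tnth.
Qed.

(** At [n.+1] the measure is a pushforward of a product, so Tonelli splits off the first
    coordinate. *)
Lemma integral_tuple_prod (R : realType) (n : nat) (f : 'I_n -> R -> R) :
  (forall i, measurable_fun [set: R] (f i)) -> (forall i x, 0 <= f i x) ->
  (\int[@lebesgue_tuple R n]_t (\prod_(i < n) f i (tnth t i))%:E =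
   \prod_(i < n) \int[lebesgue_measure]_x (f i x)%:E)%E.
Proof.
elim: n f => [|n IHn] f mf f0.
  rewrite integral_dirac//= ?diracT ?mul1e; first by rewrite !big_ord0.
  by apply/measurable_EFinP; exact: measurable_tuple_prod.
pose G (t : n.+1.-tuple R) := (\prod_(i < n.+1) f i (tnth t i))%:E.
have mG : measurable_fun [set: n.+1.-tuple R] G.
  by apply/measurable_EFinP; exact: measurable_tuple_prod.
transitivity (\int[pushforward (lebesgue_measure \x @lebesgue_tuple R n)%E
   (@cons_pair R n)]_t G t)%E; first by [].
rewrite (ge0_integral_pushforward (@measurable_cons_pair R n)
  (lebesgue_measure \x @lebesgue_tuple R n)%E)//; last first.
  by move=> t _; rewrite lee_fin prodr_ge0.
rewrite preimage_setT fubini_tonelli1/=; last 2 first.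
- by apply: measurableT_comp => //; exact: measurable_cons_pair.
- by move=> t; rewrite lee_fin prodr_ge0.
rewrite /fubini_F big_ord_recl.
pose P := (\prod_(i < n) \int[lebesgue_measure]_x (f (lift ord0 i) x)%:E)%E.
transitivity (\int[lebesgue_measure]_x ((f ord0 x)%:E * P))%E.
  apply: eq_integral => x _; rewrite /P -IHn// -ge0_integralZl_EFin//.
  - apply: eq_integral => y _; rewrite /G /= big_ord_recl -EFinM.
    congr (_ * _)%:E; apply: eq_bigr => i _.
    by rewrite /cons_pair tnthS.
  - by move=> t _; rewrite lee_fin prodr_ge0.
  - by apply/measurable_EFinP;
    exact: (measurable_tuple_prod _ _ (fun i => f (lift ord0 i))).
rewrite ge0_integralZr//.
- by apply/measurable_EFinP; exact: mf.
- by move=> x _; rewrite lee_fin.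
- by rewrite /P; apply: prode_ge0 => i _; apply: integral_ge0 => x _;
  rewrite lee_fin.
Qed.

Lemma integrable_tuple_prod (R : realType) (n : nat) (f : 'I_n -> R -> R)
    (m : 'I_n -> R) :
  (forall i, measurable_fun [set: R] (f i)) -> (forall i x, 0 <= f i x) ->
  (forall i, \int[lebesgue_measure]_x (f i x)%:E = (m i)%:E)%E ->
  (@lebesgue_tuple R n).-integrable setT
    (EFin \o (fun t : n.-tuple R => \prod_(i < n) f i (tnth t i))) /\
  \int[@lebesgue_tuple R n]_t (\prod_(i < n) f i (tnth t i)) =
  \prod_(i < n) m i.
Proof.
move=> mf f0 intf.
have I : (\int[@lebesgue_tuple R n]_t (\prod_(i < n) f i (tnth t i))%:E =
    (\prod_(i < n) m i)%:E)%E.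
  rewrite integral_tuple_prod// -prodEFin; exact: eq_bigr.
split; last by rewrite /Rintegral I.
apply/integrableP; split.
  by apply/measurable_EFinP; exact: measurable_tuple_prod.
rewrite (eq_integral (fun t => (\prod_(i < n) f i (tnth t i))%:E)); last first.
  by move=> t _; rewrite gee0_abs// lee_fin prodr_ge0.
by rewrite I ltry.
Qed.

(** Composing with a transposition shows that the sum over [s] does not depend on [i]. Summing it
    over all indices and exchanging the sums, each permutation contributes the full sum of [g]. *)
Lemma sum_perm_apply (R : pzRingType) (n : nat) (g : 'I_n -> R) (i : 'I_n) :
  (\sum_(s : 'S_n) g (s i)) *+ n = (\sum_j g j) *+ n`!.
Proof.
have sym j : \sum_(s : 'S_n) g (s j) = \sum_(s : 'S_n) g (s i).
  rewrite (reindex_inj (mulgI (tperm i j)))/=; apply: eq_bigr => s _.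
  by rewrite permM tpermR.
transitivity (\sum_j \sum_(s : 'S_n) g (s j)).
  by rewrite (eq_bigr _ (fun j _ => sym j)) sumr_const card_ord.
rewrite exchange_big/= (eq_bigr (fun=> \sum_j g j)) => [|s _].
  by rewrite sumr_const card_Sn.
by rewrite [RHS](reindex_inj (@perm_inj _ s)).
Qed.

(** Replacing [t] by [s * t] cancels the sign of [s], and reindexing the product by [s] moves the
    mark from [i0] to [s i0]. The inner sum becomes a determinant with column [s i0] shifted, and
    [sum_perm_apply] handles the sum over [s]. *)
Lemma sum_perm_pair_det (R : comNzRingType) (n k : nat)
    (mu : nat -> R) (i0 : 'I_n) :
  (\sum_(s : 'S_n) \sum_(t : 'S_n) (-1) ^+ s * (-1) ^+ t *
     \prod_(i < n) mu (s i + t i + k * (i == i0))%N) *+ n =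
  (\sum_(j < n)
     \det (\matrix_(i < n, p < n) mu (i + (p + k * (p == j)))%N)) *+ n`!.
Proof.
rewrite -(sum_perm_apply _ _ _ i0); congr (_ *+ _); apply: eq_bigr => s _.
rewrite -det_tr /determinant (reindex_inj (mulgI s))/=; apply: eq_bigr => t _.
rewrite odd_permM signr_addb mulrA -expr2 sqrr_sign mul1r; congr (_ * _).
rewrite [RHS](reindex_inj (@perm_inj _ s)); apply: eq_bigr => i _.
by rewrite !mxE permM (inj_eq perm_inj) addnCA addnA.
Qed.

Lemma vandermonde_sqE (R : realType) (n : nat) (x : n.-tuple R) :
  vandermonde_sq x = \sum_(s : 'S_n) \sum_(t : 'S_n) (-1) ^+ s * (-1) ^+ t *
     \prod_(i < n) tnth x i ^+ (s i + t i).
Proof.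
have -> : vandermonde_sq x = (\det (Vandermonde n (\row_i tnth x i))) ^+ 2.
  rewrite det_Vandermonde /vandermonde_sq -prodrXl; apply: eq_bigr => i _.
  rewrite -prodrXl; apply: eq_bigr => j _; rewrite !mxE.
  by rewrite -sqrrN opprB.
rewrite -det_tr expr2 /determinant mulr_suml; apply: eq_bigr => s _.
rewrite mulr_sumr; apply: eq_bigr => t _; rewrite mulrACA; congr (_ * _).
by rewrite -big_split/=; apply: eq_bigr => i _; rewrite !mxE exprD.
Qed.

Lemma Rintegral_sum d (T : measurableType d) (R : realType)
    (m : {measure set T -> \bar R}) (I : Type) (r : seq I) (f : I -> T -> R) :
  (forall i, m.-integrable setT (EFin \o f i)) ->
  \int[m]_x (\sum_(i <- r) f i x) = \sum_(i <- r) \int[m]_x f i x.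
Proof.
move=> intf.
have intS s :
    m.-integrable setT (EFin \o (fun x => \sum_(i <- s) f i x)).
  rewrite (_ : EFin \o _ = (fun x => \sum_(i <- s) (f i x)%:E)%E).
    by apply: (@integrable_sum _ _ _ m setT measurableT I s xpredT
      (fun i x => (f i x)%:E)) => i _; exact: intf.
  by apply/funext => x /=; rewrite sumEFin.
elim: r => [|i r IHr].
  by under eq_Rintegral do rewrite big_nil;
    rewrite big_nil Rintegral_cst// mul0r.
under eq_Rintegral do rewrite big_cons.
by rewrite big_cons RintegralD// IHr.
Qed.

Lemma integrable_scale d (T : measurableType d) (R : realType)
    (m : {measure set T -> \bar R}) (r : R) (f : T -> R) :
  m.-integrable setT (EFin \o f) ->
  m.-integrable setT (EFin \o (fun x => r * f x)).
Proof.
move=> /(integrableZl measurableT r).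
by apply: eq_integrable => // x _ /=; rewrite EFinM.
Qed.

(** Ensures that the denominator of the ratio [J_k] is nonzero. *)
Lemma det_beta_moments_neq0 (F : numFieldType) (n : nat) (a c : F) :
  0 < a -> 0 < c - a ->
  \det (\matrix_(i < n, p < n) (rising a (i + p) / rising c (i + p))) != 0.
Proof.
move=> a0 ca; have c0 : 0 < c by rewrite -(subrK a c) addr_gt0.
rewrite (det_beta_moments _ _ _ _ (fun p : 'I_n => p : nat))// !mulf_neq0//.
- apply/prodf_neq0 => j _.
  by rewrite mulf_neq0 ?invr_eq0// gt_eqF// rising_gt0.
- exact: det_beta_row_poly_neq0.
- rewrite det_Vandermonde; apply/prodf_neq0 => i _; apply/prodf_neq0 => j ij.
  by rewrite !mxE subr_eq0 eqr_nat gtn_eqF.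
Qed.

Lemma selberg_sum (R : realType) (n k : nat) (a b : R) : 1 < a -> 1 < b ->
  selberg n.+1 k a b = (n.+1`!)%:R^-1 *
   \sum_(s : 'S_n.+1) \sum_(t : 'S_n.+1) (-1) ^+ s * (-1) ^+ t *
   \prod_(i < n.+1) (beta_integral (a - 1) (b - 1) *
     (rising a (s i + t i + k * (i == ord0)) /
      rising (a + b) (s i + t i + k * (i == ord0)))).
Proof.
move=> a1 b1; rewrite /selberg; congr (_ * _).
pose e (st : 'S_n.+1 * 'S_n.+1) (i : 'I_n.+1) :=
  (st.1 i + st.2 i + k * (i == ord0))%N.
pose f st i := selberg_factor R a b (e st i).
pose m i := beta_integral (a - 1) (b - 1) * (rising a i / rising (a + b) i).
have I st := integrable_tuple_prod R _ (f st) (fun i => m (e st i))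
  (fun i => measurable_selberg_factor R a b (e st i))
  (fun i => selberg_factor_ge0 R a b (e st i))
  (fun i => integral_selberg_factor R a b (e st i) a1 b1).
pose sg (st : 'S_n.+1 * 'S_n.+1) : R := (-1) ^+ st.1 * (-1) ^+ st.2.
rewrite Rintegral_mkcond.
transitivity (\int[@lebesgue_tuple R n.+1]_x
   \sum_(st : 'S_n.+1 * 'S_n.+1) (sg st * \prod_(i < n.+1) f st i (tnth x i))).
  apply: eq_Rintegral => x _; rewrite patchE; case: ifPn => xc.
    rewrite vandermonde_sqE mulr_sumr mulr_suml -(pair_bigA _ (fun s t =>
       sg (s, t) * \prod_(i < n.+1) f (s, t) i (tnth x i)))/=.
    apply: eq_bigr => s _; rewrite mulr_sumr mulr_suml; apply: eq_bigr => t _.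
    rewrite mulrCA -!mulrA; congr (_ * _).
    (* The power of the first coordinate is spread over all coordinates, with exponent [0] away from
       [ord0], to merge into the product. *)
    have -> : x`_0 ^+ k = \prod_(i < n.+1) tnth x i ^+ (k * (i == ord0)).
      rewrite (bigD1 ord0)//= muln1 big1 ?mulr1.
        by rewrite (tnth_nth 0).
      by move=> i /negbTE ->; rewrite muln0.
    rewrite -!big_split/=; congr (_ * _); apply: eq_bigr => i _.
    rewrite /f /selberg_factor patchE ifT; last first.
      by move: xc; rewrite !inE => /(_ i) /=; rewrite in_itv.
    by rewrite /e/= !exprD; ring.
  (* Outside the cube some coordinate leaves [[0, 1]], and its factor annihilates every summand. *)
  have /existsNP[i xi] : ~ unit_cube x.
    by move=> cx; move/negP: xc; apply; rewrite inE.
  rewrite big1// => st _; rewrite (bigD1 i)//= /f /selberg_factor patchE ifF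
    ?mul0r ?mulr0//.
  by apply/negP; rewrite inE/= in_itv.
rewrite Rintegral_sum; last first.
  by move=> st; apply: integrable_scale; exact: (I st).1.
rewrite [RHS](pair_bigA _ (fun s t : 'S_n.+1 =>
  (-1) ^+ s * (-1) ^+ t * \prod_(i < n.+1) m (e (s, t) i)))/=.
apply: eq_bigr => st _.
by rewrite RintegralZl// ?(I st).2//; exact: (I st).1.
Qed.

Lemma selberg_ratioE (R : realType) (n k : nat) (a b : R) :
  1 < a -> 1 < b -> (0 < k <= n)%N ->
  selberg_ratio n k a b =
  (n%:R * k`!%:R)^-1 * backward_diff k.-1 (fun r => \prod_(s < k)
    ((n%:R + s%:R - r%:R) * (a + n%:R - 1 + s%:R - r%:R) /
     (a + b + n%:R + n%:R - 2 + s%:R - r%:R))) 0.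
Proof.
case: n => [|n] a1 b1 kn; first by lia.
have a0 : 0 < a by rewrite (lt_trans ltr01).
have ab : 0 < a + b - a by rewrite addrC addKr (lt_trans ltr01).
pose B := beta_integral (a - 1) (b - 1).
have B0 : B != 0 by rewrite gt_eqF// beta_integral_gt0// subr_gt0.
pose h i := rising a i / rising (a + b) i.
pose D j k := \det (\matrix_(i < n.+1, p < n.+1) h (i + (p + k * (p == j)))%N).
(* The factor [n.+1] makes [sum_perm_pair_det] applicable, whose factorial cancels the
   normalization; each determinant of size [n.+1] releases [B ^+ n.+1]. *)
have SE q : n.+1%:R * selberg n.+1 q a b = B ^+ n.+1 * \sum_j D j q.
  rewrite selberg_sum// mulrCA mulr_natl.
  rewrite (sum_perm_pair_det _ _ _ (fun i => B * h i)).
  rewrite -[X in _ * X = _]mulr_natl mulKf ?pnatr_eq0 -?lt0n ?fact_gt0//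
    mulr_sumr.
  apply: eq_bigr => j _; rewrite -detZ; congr (\det _).
  by apply/matrixP => i p; rewrite !mxE.
have D0 j : D j 0%N = \det (\matrix_(i < n.+1, p < n.+1) h (i + p)%N).
  by congr (\det _); apply/matrixP => i p; rewrite !mxE mul0n addn0.
have nD := det_beta_moments_neq0 R n.+1 a (a + b) a0 ab.
have n0 : n.+1%:R != 0 :> R by rewrite pnatr_eq0.
rewrite /selberg_ratio -(mulKf n0 (selberg _ k _ _)).
rewrite -(mulKf n0 (selberg _ 0 _ _)).
(* Without a shift the [n.+1] determinants coincide, whence the division by the number of variables
   in the result. *)
have sD0 : \sum_j D j 0%N =
    n.+1%:R * \det (\matrix_(i < n.+1, p < n.+1) h (i + p)%N).
  by rewrite (eq_bigr _ (fun j _ => D0 j)) sumr_const card_ord -[LHS]mulr_natl.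
rewrite !SE sD0.
rewrite (sum_det_beta_moments_shift _ _ _ _ _ kn a0 ab).
rewrite backward_diff_sum prednK; last by case/andP: kn.
set S := \sum_(r < k) _; set S' := \sum_(r < k) _.
have -> : S = k`!%:R^-1 * S'.
  rewrite mulr_sumr; apply: eq_bigr => r _; rewrite add0n subn1; ring.
rewrite -/(h _); set d := \det _; have d0 : d != 0 by [].
have k0 : k`!%:R != 0 :> R by rewrite pnatr_eq0 -lt0n fact_gt0.
have Bn : B ^+ n.+1 != 0 by rewrite expf_neq0.
move: (B ^+ n.+1) Bn => C C0.
field; by rewrite d0 k0 C0 nat1r n0.
Qed.

(** * The limit *)

Lemma natr_bin_fact (F : numFieldType) (i j : nat) :
  ('C(i + j, i))%:R = (i + j)`!%:R / (i`!%:R * j`!%:R) :> F.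
Proof.
have := bin_fact (leq_addr j i); rewrite addKn => <-.
by rewrite !natrM mulfK// mulf_neq0// pnatr_eq0 -lt0n fact_gt0.
Qed.

(** With [k = (m + l + q).+1], this compares the numerical coefficients of [moment_poly] and
    [selberg_limit]; both sides reduce to the same quotient of factorials. *)
Lemma selberg_limit_coefE (F : numFieldType) (m l q : nat) :
  m.+1%:R * ('C((m + l + q).+1, q)%:R * 'C((m + l + q).+1 + l - 1, l)%:R) =
  (m + l + q).+1%:R * ('C(m + l + q, m)%:R * ('C(l + q, l)%:R *
   (((m + l + q + l)`! * m.+1`!)%N%:R /
    ((m + l + q)`! * (m + l).+1`!)%N%:R))) :> F.
Proof.
have f0 n : n`!%:R != 0 :> F by rewrite pnatr_eq0 -lt0n fact_gt0.
rewrite (_ : ((m + l + q).+1 = q + (m + l).+1)%N); last by lia.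
rewrite (_ : (q + (m + l).+1 + l - 1 = l + (m + l + q))%N); last by lia.
rewrite (natr_bin_fact _ q) (natr_bin_fact _ l) (natr_bin_fact _ l q).
rewrite -(addnA m) (natr_bin_fact _ m).
rewrite (_ : (q + (m + l).+1 = (m + (l + q)).+1)%N); last by lia.
rewrite (addnC l (m + (l + q))%N) !factS !natrM.
have := f0 (m + l)%N; have := f0 m; have := f0 l; have := f0 q.
have := f0 (m + (l + q))%N; have := f0 (l + q)%N.
have : (m + l).+1%:R != 0 :> F by rewrite pnatr_eq0.
have : m.+1%:R != 0 :> F by rewrite pnatr_eq0.
move: (m + (l + q)).+1%:R (m + l).+1%:R m.+1%:R => x y z.
move: ((m + (l + q) + l)`!%:R) => w.
move: ((m + l)`!%:R) (m`!%:R) (l`!%:R) (q`!%:R) ((m + (l + q))`!%:R)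
  ((l + q)`!%:R).
move=> x1 x2 x3 x4 x5 x6 h1 h2 h3 h4 h5 h6 h7 h8.
by field; rewrite ?h1 ?h2 ?h3 ?h4 ?h5 ?h6 ?h7 ?h8.
Qed.

(** The double sums agree term by term. Only nonnegative powers of [a1] occur, so [a1 = 0] is
    covered. *)
Lemma coef_moment_poly_limit (R : realType) (k : nat) (a1 b1 : R) :
  (0 < k)%N -> a1 + b1 + 2 != 0 ->
  (moment_poly R k a1 (a1 + b1 + 1))`_k.-1 = k%:R * selberg_limit k a1 b1.
Proof.
move=> k0 D0; rewrite coef_moment_poly /selberg_limit mulr_sumr.
apply: eq_bigr => m _; rewrite mulrA mulr_sumr; apply: eq_bigr => l _.
have lm := ltn_ord l; have mk := ltn_ord m.
set q := (k - m - 1 - l)%N; have kE : k = (m + l + q).+1 by rewrite /q; lia.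
have := selberg_limit_coefE R m l q; rewrite -kE.
have -> : (m + l + q = k - 1)%N by lia.
have -> : (l + q = k - m - 1)%N by lia.
have -> : (k - 1 + l = k + l - 1)%N by lia.
have -> : a1 + b1 + 1 + 1 = a1 + b1 + 2 by ring.
have -> : (-1) ^+ (k - m - 1) = (-1) ^+ l * (-1) ^+ q :> R.
  by rewrite -exprD; congr (_ ^+ _); lia.
have -> : (a1 + 1) ^+ (m + l).+1 = (a1 + 1) ^+ m.+1 * (a1 + 1) ^+ l.
  by rewrite -exprD addSn.
have -> : (a1 + b1 + 2) ^- (k + l) = (a1 + b1 + 2) ^- k * (a1 + b1 + 2) ^- l.
  by rewrite exprD invfM.
have -> : (1 / (a1 + b1 + 2)) ^+ k = (a1 + b1 + 2) ^- k by rewrite div1r exprVn.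
have -> : ((a1 + 1) * (a1 + b1 + 1) / (a1 + b1 + 2)) ^+ l =
   (a1 + 1) ^+ l * (a1 + b1 + 1) ^+ l * (a1 + b1 + 2) ^- l.
  by rewrite !exprMn exprVn.
have -> : (- a1) ^+ q = (-1) ^+ q * a1 ^+ q by exact: exprNn.
rewrite addn1.
(* The sign [(-1) ^+ (k - m - 1) * (-1) ^+ l] contains [(-1) ^+ l] twice; only [(-1) ^+ q], coming
   from [(- a1) ^+ q], survives. *)
have s2 : (-1) ^+ l * (-1) ^+ l = 1 :> R by rewrite -expr2 sqrr_sign.
move: s2; move: ((-1) ^+ l) => u s2; move: ((-1) ^+ q) (a1 ^+ q) => v w.
move: ((a1 + b1 + 2) ^- k) ((a1 + b1 + 2) ^- l) ((a1 + 1) ^+ l)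
  ((a1 + b1 + 1) ^+ l) ((a1 + 1) ^+ m.+1) => dk dl al cl am.
set Fr := _ / _ => H.
transitivity (m.+1%:R * ('C(k, q)%:R * 'C(k + l - 1, l)%:R) *
  (am * al * v * w * cl * dk * dl)).
  by ring.
rewrite H -[LHS]mulr1 -s2; ring.
Qed.

Lemma backward_diff_scale (R : pzRingType) (c : R) (f : nat -> R) (j r : nat) :
  backward_diff j (fun i => c * f i) r = c * backward_diff j f r.
Proof. by elim: j r => //= j IH r; rewrite !IH mulrBr. Qed.

Lemma inv_linear_poly_exp (F : fieldType) (K k : nat) (l : F) : l != 0 ->
  'X^K %| ((l%:P + 'X) * inv_linear_poly F K l) ^+ k - 1.
Proof. by move=> l0; rewrite subrX1 dvdp_mulr// inv_linear_polyE. Qed.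

(** Multiplied by [((a1 + b1 + 2)%:P + 'X) ^+ k], a unit modulo ['X^k], the power on the left and
    [moment_poly] become congruent to the same polynomial, so their coefficients below degree [k]
    agree. *)
Lemma limit_coefE (R : realType) (k : nat) (a1 b1 : R) :
  (0 < k)%N -> a1 + b1 + 2 != 0 ->
  (((1%:P + 'X) * ((a1 + 1)%:P + 'X) *
    inv_linear_poly R k (a1 + b1 + 2)) ^+ k)`_k.-1
  = k%:R * selberg_limit k a1 b1.
Proof.
move=> k0 D0; rewrite -coef_moment_poly_limit//.
apply/eqP; rewrite -subr_eq0 -coefB; apply/eqP.
apply: (dvdp_Xn_coef _ k); last by rewrite prednK.
rewrite -(Gauss_dvdpr _ (coprimep_Xn_linear _ k k _ D0)).
have := moment_poly_congr R k a1 (a1 + b1 + 1) k0.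
rewrite -addrA (_ : 1 + 1 = 2)// => /(_ D0).
have := inv_linear_poly_exp _ k k _ D0.
set L := (_ + _)%:P + 'X; set Q := moment_poly _ _ _ _;
  set V := inv_linear_poly _ _ _.
set A := _%:P + 'X => h1 h2.
have -> : L ^+ k * (((1%:P + 'X) * A * V) ^+ k - Q) =
   ((1 + 'X) * A) ^+ k * ((L * V) ^+ k - 1) -
   (L ^+ k * Q - ((1 + 'X) * A) ^+ k).
  by rewrite polyC1 !exprMn; ring.
by rewrite dvdp_sub// dvdp_mull.
Qed.

Lemma cvg_natr_div (R : realType) : N%:R / N%:R @[N --> \oo] --> (1 : R).
Proof.
apply: cvg_near_cst; near=> N; rewrite divff// pnatr_eq0 -lt0n.
by near: N; exact: nbhs_infty_gt.
Unshelve. all: by end_near. Qed.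

Theorem mainTheorem1 (R : realType) (k : nat) (a1 b1 : R) (a b : nat -> R)
  (hk : (1 <= k)%N) (ha1 : 0 <= a1) (hb1 : 0 <= b1)
  (a_gt0 : forall N : nat, (0 < N)%N -> 0 < a N)
  (b_gt0 : forall N : nat, (0 < N)%N -> 0 < b N)
  (a_infty : a N @[N --> \oo] --> +oo)
  (b_infty : b N @[N --> \oo] --> +oo)
  (a_asymp : a N / N%:R @[N --> \oo] --> a1)
  (b_asymp : b N / N%:R @[N --> \oo] --> b1) :
  selberg_ratio N k (a N) (b N) @[N --> \oo] --> selberg_limit k a1 b1.
Proof.
have D0 : 0 < a1 + b1 + 2 by lra.
(* Every linear factor of the exact formula is scaled by [N] so as to have a finite limit; the
   original product is [N ^+ k * f N r]. *)
pose f N r : R := \prod_(s < k) ((N%:R + s%:R - r%:R) / N%:R *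
  ((a N + N%:R - 1 + s%:R - r%:R) / N%:R) *
  (N%:R / (a N + b N + N%:R + N%:R - 2 + s%:R - r%:R))).
have NR := @cvg_natr_div R.
have fp : taylor_profile R k f
    (((1%:P + 'X) * ((a1 + 1)%:P + 'X) *
      inv_linear_poly R k (a1 + b1 + 2)) ^+ k).
  apply: (taylor_profile_prod R k k (fun s N r => (N%:R + s%:R - r%:R) / N%:R *
    ((a N + N%:R - 1 + s%:R - r%:R) / N%:R) *
    (N%:R / (a N + b N + N%:R + N%:R - 2 + s%:R - r%:R)))) => s.
  apply: taylor_profileM; first apply: taylor_profileM.
  - by apply: taylor_profile_linear; exact: cvg_addr_div.
  - apply: taylor_profile_linear; do 2 apply: cvg_addr_div.
    by under eq_fun do rewrite mulrDl; exact: cvgD.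
  - apply: taylor_profile_inv => //; do 2 apply: cvg_addr_div.
    rewrite (_ : a1 + b1 + 2 = a1 + b1 + 1 + 1); last by ring.
    by under eq_fun do rewrite !mulrDl; do 3 apply: cvgD => //.
have kf0 : k`!%:R != 0 :> R by rewrite pnatr_eq0 -lt0n fact_gt0.
have lim : k`!%:R^-1 * (N%:R ^+ k.-1 * backward_diff k.-1 (f N) 0)
    @[N --> \oo] --> selberg_limit k a1 b1.
  have -> : selberg_limit k a1 b1 = k`!%:R^-1 *
     ((((1%:P + 'X) * ((a1 + 1)%:P + 'X) *
       inv_linear_poly R k (a1 + b1 + 2)) ^+ k)`_k.-1
      * k.-1`!%:R).
    rewrite limit_coefE ?gt_eqF// mulrAC -natrM mulrA.
    have -> : (k * k.-1`! = k`!)%N by rewrite -{1 3}(prednK hk) factS.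
    by rewrite mulVf// mul1r.
  by apply: cvgM; [exact: cvg_cst|apply: fp; rewrite prednK].
apply: cvg_trans lim; apply: near_eq_cvg.
(* The exact formula requires parameters above [1], which holds eventually because both diverge. *)
have a2 : \forall N \near \oo, 1 < a N by move/cvgryPgt: a_infty; exact.
have b2 : \forall N \near \oo, 1 < b N by move/cvgryPgt: b_infty; exact.
near=> N.
have kN : (k <= N)%N by near: N; exact: nbhs_infty_ge.
have N0 : N%:R != 0 :> R by rewrite pnatr_eq0 -lt0n (leq_trans hk).
rewrite selberg_ratioE ?hk//; last 2 first.
- by near: N.
- by near: N.
rewrite [X in _ = _ * backward_diff _ X _](_ : _ =
  (fun r => N%:R ^+ k * f N r)); last first.
  apply/funext => r; rewrite /f -[in N%:R ^+ k](card_ord k) -prodr_const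
    -big_split/=.
  apply: eq_bigr => s _; move: (_^-1) => w.
  by field.
(* One factor of [N ^+ k] cancels the prefactor [1 / N]; the remaining [N ^+ k.-1] is the scaling of
   a difference of order [k.-1]. *)
rewrite backward_diff_scale -[in N%:R ^+ k](prednK hk) exprS; field.
by rewrite N0 kf0.
Unshelve. all: by end_near. Qed.
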